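(* Let $W$ be a restricted $\mathcal{L}^*$-module of level $\ell_{1234}$. Then there exists a $\phi$-coordinated $V_{\widehat{\mathfrak{L}^*}}(\ell_{1234},0)$-module structure $Y_W(\cdot,x)$ on $W$, uniquely determined by $$Y_W((T^m)_{-1}\mathbf{1},x)=T_m(x),\qquad Y_W((E^m)_{-1}\mathbf{1},x)=E_m(x)\qquad(m\in\mathbb{Z}).$$
   Context: The rank two twisted Heisenberg–Virasoro algebra $\mathcal{L}^*$ has basis $\{t_1^mt_2^n, E_{m,n}: (m,n)\in\mathbb{Z}^2\setminus\{(0,0)\}\}\cup\{K_1,K_2,K_3,K_4\}$, $K_i$ central, with $[t_1^mt_2^n,t_1^rt_2^s]=0$, $[t_1^mt_2^n,E_{r,s}]=(nr-ms)t_1^{m+r}t_2^{n+s}+\delta_{m+r,0}\delta_{n+s,0}(mK_1+nK_2)$, $[E_{m,n},E_{r,s}]=(nr-ms)E_{m+r,n+s}+\delta_{m+r,0}\delta_{n+s,0}(mK_3+nK_4)$ (terms with index $(0,0)$ are interpreted as $0$). Set $T_m(x)=\sum_{n\in\mathbb{Z}}t_1^mt_2^nx^{-n}$ and $E_m(x)=\sum_nE_{m,n}x^{-n}$ (omitting $(0,0)$ terms). An $\mathcal{L}^*$-module $W$ is restricted if $T_m(x),E_m(x)\in\mathrm{Hom}(W,W((x)))$ for all $m$, i.e. for each $w$, $t_1^mt_2^nw=0$ and $E_{m,n}w=0$ for $n$ sufficiently large; it has level $\ell_{1234}$ if $K_i$ acts as $\ell_i\in\mathbb{C}$. $\widehat{\mathfrak{L}^*}$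 is the Lie algebra with basis $\{T^m\otimes t^n, E^r\otimes t^s:(m,n),(r,s)\in\mathbb{Z}^2\}\cup\{K_1,\dots,K_4\}$, $K_i$ central, $[T^m\otimes t^n,T^r\otimes t^s]=0$, $[T^m\otimes t^n,E^r\otimes t^s]=(nr-ms)T^{m+r}\otimes t^{n+s-1}+m\delta_{m+r,0}\delta_{n+s+1,0}K_1+n\delta_{m+r,0}\delta_{n+s,0}K_2$, $[E^m\otimes t^n,E^r\otimes t^s]=(nr-ms)E^{m+r}\otimes t^{n+s-1}+m\delta_{m+r,0}\delta_{n+s+1,0}K_3+n\delta_{m+r,0}\delta_{n+s,0}K_4$. Write $(T^m)_n=T^m\otimes t^n$, $(E^r)_s=E^r\otimes t^s$. $V_{\widehat{\mathfrak{L}^*}}(\ell_{1234},0)=U(\widehat{\mathfrak{L}^*})\otimes_{U(\widehat{\mathfrak{L}^*}_{\ge0})}\mathbb{C}$, where $\widehat{\mathfrak{L}^*}_{\ge0}$ is spanned by $T^m\otimes t^n,E^r\otimes t^n$ ($n\ge0$) acting as $0$ and $K_i$ acting as $\ell_i$; $\mathbf{1}=1\otimes1$. It is a vertex algebra with vacuum $\mathbf{1}$, $Y((T^m)_{-1}\mathbf{1},x)=\sum_n(T^m)_nx^{-n-1}$, $Y((E^r)_{-1}\mathbf{1},x)=\sum_s(E^r)_sx^{-s-1}$, generated by $\{(T^m)_{-1}\mathbf{1},(E^r)_{-1}\mathbf{1}\}$. A $\phi$-coordinated module ($\phi(x,z)=xe^z$) for a vertex algebra $V$ is a space $W$ with a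 linear map $Y_W(\cdot,x):V\to\mathrm{Hom}(W,W((x)))$ such that $Y_W(\mathbf{1},x)=\mathbf{1}_W$ and for $u,v\in V$ there is $k\in\mathbb{N}$ with $(x_1-x_2)^kY_W(u,x_1)Y_W(v,x_2)\in\mathrm{Hom}(W,W((x_1,x_2)))$ and $(x_2e^z-x_2)^kY_W(Y(u,z)v,x_2)=((x_1-x_2)^kY_W(u,x_1)Y_W(v,x_2))|_{x_1=x_2e^z}$. *)

(* Defs.v *)
From HB Require Import structures.
From mathcomp Require Import all_boot all_order all_algebra.
From mathcomp Require Import complex.
From mathcomp Require Import Rstruct.
From Stdlib Require Import Rdefinitions.

Set Implicit Arguments.
Unset Strict Implicit.
Unset Printing Implicit Defensive.

Import Order.TTheory GRing.Theory Num.Theory.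
Local Open Scope ring_scope.

Notation C := (complex Rdefinitions.R).

Definition islin (U V : lmodType C) (f : U -> V) : Prop :=
  forall (a : C) (x y : U), f (a *: x + y) = a *: f x + f y.

Definition kd (a b : int) : C := if a == b then 1 else 0.

Definition zbinom (p : int) (i : nat) : C :=
  (\prod_(j < i) (p%:~R - j%:R)) / (i`!)%:R.

(* Modules for the rank two twisted Heisenberg-Virasoro algebra L^*.         *)
(* A module structure is given by operators tW m n (action of t_1^m t_2^n)   *)
(* and EW m n (action of E_{m,n}) for (m,n) <> (0,0); the values at (0,0)    *)
(* are irrelevant (never used).  The central elements K_i act as l_i         *)
(* (level l_{1234}), which is built into the bracket relations.              *)

Definition nz (m n : int) : bool := (m != 0) || (n != 0).

Definition tz (W : lmodType C) (tW : int -> int -> W -> W) (m n : int) (w : W) : W :=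
  if nz m n then tW m n w else 0.

Definition Lstar_module (l1 l2 l3 l4 : C) (W : lmodType C)
    (tW EW : int -> int -> W -> W) : Prop :=
  (forall m n, islin (tW m n)) /\ (forall m n, islin (EW m n)) /\
  (forall m n r s w, nz m n -> nz r s ->
     tW m n (tW r s w) - tW r s (tW m n w) = 0) /\
  (forall m n r s w, nz m n -> nz r s ->
     tW m n (EW r s w) - EW r s (tW m n w) =
       (n * r - m * s)%:~R *: tz tW (m + r) (n + s) w
       + (kd (m + r) 0 * kd (n + s) 0 * (m%:~R * l1 + n%:~R * l2)) *: w) /\
  (forall m n r s w, nz m n -> nz r s ->
     EW m n (EW r s w) - EW r s (EW m n w) =
       (n * r - m * s)%:~R *: tz EW (m + r) (n + s) w
       + (kd (m + r) 0 * kd (n + s) 0 * (m%:~R * l3 + n%:~R * l4)) *: w).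

(* restricted: T_m(x), E_m(x) in Hom(W, W((x))) *)
Definition restricted (W : lmodType C) (tW EW : int -> int -> W -> W) : Prop :=
  forall (m : int) (w : W), exists N : int, forall n : int, N <= n ->
    tW m n w = 0 /\ EW m n w = 0.

(* Modules for the Lie algebra \hat{L^*} of level l_{1234}:                  *)
(* TV m n = action of T^m (x) t^n,  EV r s = action of E^r (x) t^s.          *)

Definition Lhat_module (l1 l2 l3 l4 : C) (M : lmodType C)
    (TV EV : int -> int -> M -> M) : Prop :=
  (forall m n, islin (TV m n)) /\ (forall m n, islin (EV m n)) /\
  (forall m n r s w, TV m n (TV r s w) - TV r s (TV m n w) = 0) /\
  (forall m n r s w,
     TV m n (EV r s w) - EV r s (TV m n w) =
       (n * r - m * s)%:~R *: TV (m + r) (n + s - 1) w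
       + (m%:~R * kd (m + r) 0 * kd (n + s + 1) 0 * l1
          + n%:~R * kd (m + r) 0 * kd (n + s) 0 * l2) *: w) /\
  (forall m n r s w,
     EV m n (EV r s w) - EV r s (EV m n w) =
       (n * r - m * s)%:~R *: EV (m + r) (n + s - 1) w
       + (m%:~R * kd (m + r) 0 * kd (n + s + 1) 0 * l3
          + n%:~R * kd (m + r) 0 * kd (n + s) 0 * l4) *: w).

(* w is annihilated by \hat{L^*}_{>=0} (apart from the K_i, acting as l_i) *)
Definition nonneg_annihilated (M : lmodType C) (TV EV : int -> int -> M -> M)
    (w : M) : Prop :=
  forall m n : int, 0 <= n -> TV m n w = 0 /\ EV m n w = 0.

(* (V, TV, EV, vac) is the induced module
     V_{\hat{L^*}}(l_{1234},0) = U(\hat{L^*}) (x)_{U(\hat{L^*}_{>=0})} C,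
   vac = 1 (x) 1, characterized by its universal property: for every
   \hat{L^*}-module M of level l_{1234} and every w in M annihilated by
   \hat{L^*}_{>=0}, there is a unique module homomorphism V -> M sending
   vac to w. *)
Definition vacuum_module (l1 l2 l3 l4 : C) (V : lmodType C)
    (TV EV : int -> int -> V -> V) (vac : V) : Prop :=
  Lhat_module l1 l2 l3 l4 TV EV /\ nonneg_annihilated TV EV vac /\
  forall (M : lmodType C) (TM EM : int -> int -> M -> M) (w : M),
    Lhat_module l1 l2 l3 l4 TM EM -> nonneg_annihilated TM EM w ->
    (exists f : V -> M, islin f /\ f vac = w /\
        (forall m n v, f (TV m n v) = TM m n (f v)) /\
        (forall m n v, f (EV m n v) = EM m n (f v))) /\
    (forall f g : V -> M,
        islin f -> f vac = w ->
        (forall m n v, f (TV m n v) = TM m n (f v)) ->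
        (forall m n v, f (EV m n v) = EM m n (f v)) ->
        islin g -> g vac = w ->
        (forall m n v, g (TV m n v) = TM m n (g v)) ->
        (forall m n v, g (EV m n v) = EM m n (g v)) ->
        forall v, f v = g v).

(* Vertex algebras.  YV u n v = u_n v, where Y(u,x) = \sum_n u_n x^{-n-1}.   *)

Definition vertex_algebra (V : lmodType C) (vac : V) (YV : V -> int -> V -> V)
    : Prop :=
  (* Y(.,x) is a linear map V -> Hom(V, V((x))) *)
  (forall n v, islin (fun u => YV u n v)) /\
  (forall u n, islin (YV u n)) /\
  (forall u v, exists N : int, forall n : int, N <= n -> YV u n v = 0) /\
  (forall n v, YV vac n v = if n == -1 then v else 0) /\
  (forall u n, 0 <= n -> YV u n vac = 0) /\
  (forall u, YV u (-1) vac = u) /\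
  (* Jacobi identity, in component (Borcherds) form; all sums are finite
     once N is beyond the truncation bounds *)
  (forall (u v w : V) (p q r : int) (N : nat),
     (forall i : nat, leq N i ->
        YV u (r + i%:Z) v = 0 /\ YV v (q + i%:Z) w = 0 /\ YV u (p + i%:Z) w = 0) ->
     \sum_(i < N) zbinom p i *: YV (YV u (r + i%:Z) v) (p + q - i%:Z) w =
     \sum_(i < N) ((-1) ^+ i * zbinom r i) *:
        (YV u (p + r - i%:Z) (YV v (q + i%:Z) w)
         - (-1) ^ r *: YV v (q + r - i%:Z) (YV u (p + i%:Z) w))).

(* phi-coordinated modules, phi(x,z) = x e^z.                                *)
(* YW v n w = coefficient of x^n in Y_W(v,x) w.                              *)

(* coefficient of x1^a x2^b in (x1 - x2)^k Y_W(u,x1) Y_W(v,x2) w *)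
Definition prod_coef (V W : lmodType C) (YW : V -> int -> W -> W)
    (k : nat) (u v : V) (w : W) (a b : int) : W :=
  \sum_(p < k.+1) ('C(k, p)%:R * (-1) ^+ (k - p)) *:
      YW u (a - p%:Z) (YW v (b - k%:Z + p%:Z) w).

(* coefficient of x2^c z^r (r >= 0) in  F(x2 e^z, x2), for
   F = \sum_{a,b >= N} F_{a,b} x1^a x2^b :
     (1/r!) \sum_{a+b=c, a,b >= N} a^r F_{a,b} *)
Definition subst_coef (W : lmodType C) (F : int -> int -> W) (N c : int) (r : nat)
    : W :=
  (r`!%:R)^-1 *:
    \sum_(i < absz (c - 2 * N + 1) | (i%:Z <= c - 2 * N))
        ((N + i%:Z)%:~R ^+ r) *: F (N + i%:Z) (c - N - i%:Z).

(* coefficient of x2^c z^q in (x2 e^z - x2)^k Y_W(Y(u,z)v, x2) w, where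
   (x2 e^z - x2)^k = x2^k \sum_p binom(k,p) (-1)^(k-p) e^{pz} and
   Y(u,z)v = \sum_n u_n v z^{-n-1} with u_n v = 0 for n >= M *)
Definition assoc_coef (V W : lmodType C) (YV : V -> int -> V -> V)
    (YW : V -> int -> W -> W) (k : nat) (u v : V) (w : W) (M c q : int) : W :=
  \sum_(p < k.+1) ('C(k, p)%:R * (-1) ^+ (k - p)) *:
    \sum_(j < absz (q + M + 1) | (j%:Z < q + M + 1))
       ((j`!%:R)^-1 * (p%:R ^+ j)) *:
          YW (YV u (j%:Z - q - 1) v) (c - k%:Z) w.

Definition phi_coordinated_module (V W : lmodType C) (vac : V)
    (YV : V -> int -> V -> V) (YW : V -> int -> W -> W) : Prop :=
  (* Y_W(.,x) is a linear map V -> Hom(W, W((x))) *)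
  (forall n w, islin (fun v => YW v n w)) /\
  (forall v n, islin (YW v n)) /\
  (forall v w, exists N : int, forall n : int, n < N -> YW v n w = 0) /\
  (forall n w, YW vac n w = if n == 0 then w else 0) /\
  (forall u v : V, exists k : nat, forall w : W,
     exists N : int,
       (* (x1-x2)^k Y_W(u,x1)Y_W(v,x2) w in W((x1,x2)) *)
       (forall a b : int, (a < N) || (b < N) -> prod_coef YW k u v w a b = 0) /\
       (* (x2 e^z - x2)^k Y_W(Y(u,z)v,x2) w
            = ((x1-x2)^k Y_W(u,x1)Y_W(v,x2) w)|_{x1 = x2 e^z} *)
       (forall M : int, (forall n : int, M <= n -> YV u n v = 0) ->
         forall c q : int,
           assoc_coef YV YW k u v w M c q =
           if q < 0 then 0
           else subst_coef (prod_coef YW k u v w) N c (absz q))).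

(* the generating-field conditions
     Y_W((T^m)_{-1} 1, x) = T_m(x) = \sum_n t_1^m t_2^n x^{-n},
     Y_W((E^m)_{-1} 1, x) = E_m(x) = \sum_n E_{m,n} x^{-n}   ((0,0) omitted) *)
Definition generating_fields (V W : lmodType C) (TV EV : int -> int -> V -> V)
    (vac : V) (tW EW : int -> int -> W -> W) (YW : V -> int -> W -> W) : Prop :=
  forall (m n : int) (w : W),
    YW (TV m (-1) vac) n w = tz tW m (- n) w /\
    YW (EV m (-1) vac) n w = tz EW m (- n) w.

(* Main.v *)
(* For fields c(x1), d(x2) on W put xi = x1/x2 = exp z. The residue at xi = 1 of a rational
   function of xi times c d, computed as the residue at oo of c(x1) d(x2) minus the residue at
   0 of d(x2) c(x1), gives the (xi - 1)^i-product of c and d; for mutually local c, d only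
   finitely many i >= 0 contribute, so z = log(1 + (xi - 1)) may be substituted, which gives
   products with z^n.
   Since left and right multiplication by modes commute, the z^n-products with the generating
   fields T_m(x), E_m(x) satisfy the relations of \hat{L^*} on the space of all fields local
   with the generating ones, and the identity field is a vacuum vector there. The universal
   property of V sends v to a field c_v, and c_{u_n v} = (c_u)_{z^n} c_v follows by induction
   on v (not on u) from the commutator formula; the base case v = 1 is c_{D u} = x d/dx c_u.
   This is weak associativity, hence the module structure. For uniqueness, the associativity
   axiom determines the fields of a_n v from those of a and v, because (exp z - 1)^k is not a
   zero divisor. *)
From HB Require Import structures.
Require Import Defs.
From mathcomp Require Import all_boot all_order all_algebra.
From mathcomp Require Import complex Rstruct.
From mathcomp Require Import boolp classical_sets functions fsbigop.
From mathcomp Require Import ring zify.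
Set Implicit Arguments.
Unset Strict Implicit.
Unset Printing Implicit Defensive.
Import Order.TTheory GRing.Theory Num.Theory.
Local Open Scope ring_scope.

(** * Finitely supported sums over the integers *)

Section IntegerSums.
Variable U : lmodType C.
Implicit Types (f g : int -> U) (N : int).

Definition bounded f := exists N, forall i, (i < - N) || (N < i) -> f i = 0.
Definition bounded2 (f : int -> int -> U) :=
  exists N, forall i j,
    [|| i < - N, N < i, j < - N | N < j] -> f i j = 0.

Definition zsum f : U := \sum_(i \in [set: int]%classic) f i.

Lemma zsumE f (N : nat) :
  (forall i : int, (i < - N%:Z) || (N%:Z < i) -> f i = 0) ->
  zsum f = \sum_(j < N.*2.+1) f (j%:Z - N%:Z).
Proof.
move=> f0; rewrite /zsum.
rewrite (fsbigE [seq (j%:Z - N%:Z) | j <- iota 0 N.*2.+1]) //; last first.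
- move=> i _ iN; apply: f0; case: (boolP (_ || _)) => // ib; exfalso.
  move/negP: iN; apply; apply/mapP; exists (absz (i + N)).
    by rewrite mem_iota; lia.
  lia.
- by rewrite map_inj_uniq ?iota_uniq // => x y; lia.
rewrite big_map.
rewrite (eq_bigl xpredT); last by move=> i; rewrite in_setT.
by rewrite -[RHS](big_mkord xpredT (fun j => f (j%:Z - N%:Z))) /index_iota subn0.
Qed.

Lemma eq_zsum f g : (forall i, f i = g i) -> zsum f = zsum g.
Proof. by move=> fg; congr zsum; apply/funext. Qed.

Lemma zsum0 : zsum (fun=> 0) = 0.
Proof. by rewrite (@zsumE _ 0) // big1. Qed.

Lemma zsum_reindex (h : int -> int) f : bijective h ->
  zsum f = zsum (fun i => f (h i)).
Proof. by move=> hb; rewrite /zsum (reindex_fsbigT h). Qed.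

Lemma zsum_shift k f : zsum (fun i => f (i + k)) = zsum f.
Proof.
by rewrite [RHS](zsum_reindex f (h := fun i => i + k)) //; exists (fun i => i - k) => i; ring.
Qed.

Lemma zsum_range (lo : int) (k : nat) f :
  (forall i, (i < lo) || (lo + k%:Z <= i) -> f i = 0) ->
  zsum f = \sum_(i < k) f (lo + i%:Z).
Proof.
move=> h; rewrite -(zsum_shift lo) (@zsumE _ k) => [|i hi]; last by apply: h; lia.
rewrite -addnn -addnS big_split_ord /=.
rewrite big1 => [|i _]; last by apply: h; have := ltn_ord i; lia.
rewrite add0r big_ord_recr /= [X in _ + X]h ?addr0; last by lia.
by apply: eq_bigr => i _; congr f; lia.
Qed.

Lemma zsumD f g : bounded f -> bounded g ->
  zsum (fun i => f i + g i) = zsum f + zsum g.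
Proof.
move=> [N fN] [M gM].
rewrite !(@zsumE _ (absz N + absz M)); last 3 first.
- by move=> i hi; apply: gM; lia.
- by move=> i hi; apply: fN; lia.
- by move=> i hi; rewrite fN ?gM ?addr0 //; lia.
by rewrite big_split.
Qed.

Lemma zsum1 k f : (forall i, i != k -> f i = 0) -> zsum f = f k.
Proof.
move=> f0; rewrite -(zsum_shift k) (@zsumE _ 0) ?big_ord1 ?add0r //=.
by move=> i hi; apply: f0; lia.
Qed.

Lemma boundedD f g : bounded f -> bounded g -> bounded (fun i => f i + g i).
Proof.
move=> [N fN] [M gM]; exists (`|N| + `|M|) => i hi; rewrite fN ?gM ?addr0 //; lia.
Qed.

Lemma bounded_scale (a : int -> C) f : bounded f -> bounded (fun i => a i *: f i).
Proof. by move=> [N fN]; exists N => i /fN ->; rewrite scaler0. Qed.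

Lemma bounded_range (lo hi : int) f :
  (forall i, (i < lo) || (hi < i) -> f i = 0) -> bounded f.
Proof. by move=> h; exists (`|lo| + `|hi|) => i hi'; apply: h; lia. Qed.

Lemma zsum_exchange (f : int -> int -> U) : bounded2 f ->
  zsum (fun i => zsum (f i)) = zsum (fun j => zsum (f^~ j)).
Proof.
move=> [N fN]; pose n := absz N.
have e1 i : zsum (f i) = \sum_(j < n.*2.+1) f i (j%:Z - n%:Z).
  by apply: zsumE => j hj; apply: fN; lia.
have e2 j : zsum (f^~ j) = \sum_(i < n.*2.+1) f (i%:Z - n%:Z) j.
  by apply: zsumE => i hi; apply: fN; lia.
rewrite (eq_zsum e1) (eq_zsum e2) !(@zsumE _ n); last 2 first.
- by move=> i hi; rewrite big1 // => j _; apply: fN; lia.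
- by move=> i hi; rewrite big1 // => j _; apply: fN; lia.
exact: exchange_big.
Qed.

Lemma zsum_sum (J : nat) (f : nat -> int -> U) : (forall l, (l < J)%N -> bounded (f l)) ->
  zsum (fun i => \sum_(l < J) f l i) = \sum_(l < J) zsum (f l).
Proof.
elim: J => [|J IH] fb.
  by rewrite big_ord0 -[RHS]zsum0; apply: eq_zsum => i; rewrite big_ord0.
rewrite big_ord_recr /= -IH; last by move=> l lJ; apply: fb; rewrite ltnS ltnW.
rewrite -zsumD; last by apply: fb.
- by apply: eq_zsum => i; rewrite big_ord_recr.
- elim: J {IH} fb => [|J IH] fb; first by exists 0 => i _; rewrite big_ord0.
  have [|N hN] := boundedD (IH _) (fb J (leqnSn _)).
    by move=> l lJ; apply: fb; rewrite ltnS ltnW.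
  by exists N => i /hN; rewrite big_ord_recr.
Qed.

End IntegerSums.

Section Linear.
Variables U V : lmodType C.
Implicit Types (h : U -> V).

Lemma islin0 h : islin h -> h 0 = 0.
Proof. by move=> hl; have := hl 1 0 0; rewrite !scale1r addr0 => /eqP;
  rewrite addrC -subr_eq subrr => /eqP. Qed.

Lemma islinD h x y : islin h -> h (x + y) = h x + h y.
Proof. by move=> hl; have := hl 1 x y; rewrite !scale1r. Qed.

Lemma islinZ h a x : islin h -> h (a *: x) = a *: h x.
Proof. by move=> hl; have := hl a x 0; rewrite !addr0 islin0 // addr0. Qed.

Lemma islinN h x : islin h -> h (- x) = - h x.
Proof. by move=> hl; rewrite -scaleN1r islinZ // scaleN1r. Qed.

Lemma islinB h x y : islin h -> h (x - y) = h x - h y.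
Proof. by move=> hl; rewrite islinD // islinN. Qed.

Lemma islin_sum h (I : Type) (r : seq I) (P : pred I) (f : I -> U) : islin h ->
  h (\sum_(i <- r | P i) f i) = \sum_(i <- r | P i) h (f i).
Proof.
by move=> hl; apply: (big_morph h (id1 := 0) (op1 := +%R)) => [x y|]; rewrite ?islinD ?islin0.
Qed.

Lemma islin_zsum h f : islin h -> bounded f -> h (zsum f) = zsum (fun i => h (f i)).
Proof.
move=> hl [N fN]; rewrite !(@zsumE _ _ (absz N)) ?islin_sum //.
- by move=> i hi; rewrite fN ?islin0 //; lia.
- by move=> i hi; apply: fN; lia.
Qed.

End Linear.

Lemma zsumZ (U : lmodType C) (a : C) (f : int -> U) : bounded f ->
  zsum (fun i => a *: f i) = a *: zsum f.
Proof. by move=> fb; rewrite (islin_zsum (h := *:%R a)) // => b x y;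
  rewrite scalerDr !scalerA mulrC. Qed.

Lemma zsum_scalel (U : lmodType C) (f : int -> C^o) (x : U) : bounded f ->
  zsum (fun i => f i *: x) = (zsum f : C) *: x.
Proof. by move=> fb; rewrite (islin_zsum (h := fun a : C^o => (a : C) *: x)) // => b y z;
  rewrite scalerDl scalerA. Qed.

(** * Expansions of powers of [xi - 1] *)

Lemma int_bi_ind (P : int -> Prop) : P 0 -> (forall n, P n -> P (n + 1)) ->
  (forall n, P (n + 1) -> P n) -> forall n, P n.
Proof.
move=> P0 Pu Pd; case=> n; elim: n => [|n IH] //.
- by rewrite -addn1 PoszD; apply: Pu.
- by apply: Pd; rewrite (_ : _ + 1 = 0).
- by apply: Pd; rewrite (_ : _ + 1 = Negz n) //; lia.
Qed.

Lemma int_const (T : Type) (f : int -> T) : (forall n, f (n + 1) = f n) -> forall n m, f n = f m.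
Proof.
move=> h n m; suff e k : f k = f 0 by rewrite (e n) (e m).
by elim/int_bi_ind: k => [|k|k] // e; [rewrite h | rewrite -h].
Qed.

Lemma zbinom0 p : zbinom p 0 = 1.
Proof. by rewrite /zbinom big_ord0 divr1. Qed.

Lemma zbinomS p i : zbinom p i.+1 = zbinom p i * (p%:~R - i%:R) / i.+1%:R.
Proof.
rewrite /zbinom big_ord_recr /= factS natrM invfM; ring.
Qed.

Lemma natCS_neq0 i : (i.+1%:R : C) != 0. Proof. by rewrite pnatr_eq0. Qed.

Lemma zbinom_absorb p i : zbinom (p + 1) i.+1 = zbinom p i * (p + 1)%:~R / i.+1%:R.
Proof.
rewrite /zbinom big_ord_recl /= subr0 factS natrM invfM.
under eq_bigr => j _ do rewrite /bump /= add1n -(addn1 j) natrD intrD opprD addrACA subrr addr0.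
ring.
Qed.

Lemma zbinom_pascal p i : zbinom (p + 1) i.+1 = zbinom p i.+1 + zbinom p i.
Proof.
rewrite zbinom_absorb zbinomS intrD -(addn1 i) natrD.
have h : (i%:R + 1 : C) != 0 by rewrite natr1 natCS_neq0.
by field.
Qed.

Lemma zbinom_0S i : zbinom 0 i.+1 = 0.
Proof. by elim: i => [|i IH]; rewrite zbinomS ?zbinom0 ?IH /=; [rewrite subrr|]; ring. Qed.

Lemma zbinom_nat (k p : nat) : zbinom k%:Z p = 'C(k, p)%:R.
Proof.
elim: k p => [|k IH] [|p]; rewrite ?zbinom0 ?bin0 ?bin0n ?zbinom_0S //.
by rewrite -addn1 PoszD zbinom_pascal !IH addn1 binS natrD.
Qed.

(* The coefficient of [xi ^ n] in [(xi - 1) ^ i], expanded in [1/xi] if [e], else in [xi]. *)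
Definition beta (e : bool) (i n : int) : C :=
  if e then if n <= i then (-1) ^ (i - n) * zbinom i (absz (i - n)) else 0
  else if 0 <= n then (-1) ^ (i - n) * zbinom i (absz n) else 0.

Lemma beta_side e i n : (if e then i < n else n < 0) -> beta e i n = 0.
Proof. by case: e => /= h; rewrite /beta ifF //; lia. Qed.

Lemma beta_rec e i n : beta e (i + 1) n = beta e i (n - 1) - beta e i n.
Proof.
have sg k : (-1 : C) ^ (k + 1) = - (-1) ^ k.
  by rewrite exprzDr ?unitrN1 // expr1z mulrN1.
rewrite /beta; case: e.
  rewrite (_ : i + 1 - n = i - n + 1) 1?(_ : i - (n - 1) = i - n + 1); try ring.
  rewrite sg; case: (ltrgtP n (i + 1)) => h.
  - rewrite !ifT; try lia.
    rewrite (_ : absz _ = (absz (i - n)).+1) ?zbinom_pascal; [ring | lia].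
  - by rewrite !ifF ?subr0 //; lia.
  - rewrite h (_ : (i + 1 <= i) = false); last lia.
    by rewrite addrK lexx (_ : i - (i + 1) + 1 = 0) ?zbinom0 ?subr0 //; ring.
rewrite (_ : i + 1 - n = i - n + 1) 1?(_ : i - (n - 1) = i - n + 1); try ring.
rewrite sg; case: (ltrgtP n 0) => h.
- by rewrite !ifF ?subr0 //; lia.
- rewrite !ifT; try lia.
  rewrite (_ : absz n = (absz (n - 1)).+1) ?zbinom_pascal; [ring | lia].
- by rewrite h /= !zbinom0 sub0r mulNr.
Qed.

Lemma beta0 e n : beta e 0 n = (n == 0)%:R.
Proof.
rewrite /beta; case: e; case: (ltrgtP n 0) => h //=; rewrite ?h ?zbinom0 ?mulr1 //.
- by rewrite (_ : absz _ = (absz n).-1.+1) ?zbinom_0S ?mulr0 //; lia.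
- by rewrite (_ : absz _ = (absz n).-1.+1) ?zbinom_0S ?mulr0 //; lia.
Qed.

Lemma beta_D e i n : n%:~R * beta e i n = i%:~R * (beta e i n + beta e (i - 1) n).
Proof.
have sg k : (-1 : C) ^ (k + 1) = - (-1) ^ k.
  by rewrite exprzDr ?unitrN1 // expr1z mulrN1.
suff {}H i' : n%:~R * beta e (i' + 1) n
    = (i' + 1)%:~R * (beta e (i' + 1) n + beta e i' n).
  by have := H (i - 1); rewrite subrK.
move: i' => {}i; rewrite /beta; case: e.
  rewrite (_ : i + 1 - n = i - n + 1); last by ring.
  rewrite sg; case: (ltrgtP n (i + 1)) => h.
  - rewrite !ifT; try lia.
    rewrite (_ : absz _ = (absz (i - n)).+1) ?zbinom_absorb; last lia.
    have -> : n%:~R = (i + 1)%:~R - (absz (i - n)).+1%:R :> C.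
      rewrite -[_%:R]/((absz (i - n)).+1%:~R) -intrB; congr _%:~R; lia.
    move: (natCS_neq0 (absz (i - n))) ((i + 1)%:~R : C) (zbinom _ _) ((-1) ^ _).
    by move: (_.+1%:R) => m m0 x y z; field.
  - by rewrite mulr0 ifF ?addr0 ?mulr0 //; lia.
  - rewrite h (_ : (i + 1 <= i) = false); last lia.
    by rewrite (_ : i - (i + 1) + 1 = 0) ?zbinom0 ?addr0 //; ring.
rewrite (_ : i + 1 - n = i - n + 1); last by ring.
rewrite sg; case: (ltrgtP n 0) => h.
- by rewrite addr0 !mulr0.
- rewrite (_ : absz n = (absz (n - 1)).+1); last lia.
  have -> : n%:~R = (absz (n - 1)).+1%:R :> C.
    rewrite -[RHS]/((absz (n - 1)).+1%:~R); congr _%:~R; lia.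
  rewrite (_ : zbinom i _ = zbinom (i + 1) (absz (n - 1)).+1 - zbinom i (absz (n - 1))).
    rewrite zbinom_absorb.
    move: (natCS_neq0 (absz (n - 1))) ((i + 1)%:~R : C) (zbinom _ _) ((-1) ^ _).
    by move: (_.+1%:R) => m m0 x y t; field.
  by rewrite zbinom_pascal addrK.
- by rewrite h /= !zbinom0; ring.
Qed.

Lemma beta_top i : beta true i i = 1.
Proof. by rewrite /beta lexx subrr zbinom0 mulr1. Qed.

Lemma beta_nonneg (k : nat) n : beta true k%:Z n = beta false k%:Z n.
Proof.
elim: k n => [|k IH] n; first by rewrite !beta0.
by rewrite -addn1 PoszD !beta_rec !IH.
Qed.

Lemma beta_nat (k p : nat) : (p <= k)%N -> beta true k%:Z p%:Z = 'C(k, p)%:R * (-1) ^+ (k - p).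
Proof.
move=> pk; rewrite beta_nonneg /beta /= zbinom_nat mulrC; congr (_ * _).
by rewrite subzn.
Qed.

Lemma beta_bounded (e : bool) i j k :
  bounded (fun n => beta e i n * beta e j (k - n) : C^o).
Proof.
exists (`|i| + `|j| + `|k|) => n hn; case: e.
  case: (ltrP i n) => h; first by rewrite beta_side ?mul0r.
  by rewrite mulrC beta_side ?mul0r //; lia.
case: (ltrP n 0) => h; first by rewrite beta_side ?mul0r.
by rewrite mulrC beta_side ?mul0r //; lia.
Qed.

Lemma beta_conv e i j k :
  zsum (fun n => beta e i n * beta e j (k - n) : C^o) = beta e (i + j) k.
Proof.
have rec i' k' : zsum (fun n => beta e (i' + 1) n * beta e j (k' - n) : C^o) =
    (zsum (fun n => beta e i' n * beta e j (k' - 1 - n) : C^o) : C)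
    - (zsum (fun n => beta e i' n * beta e j (k' - n) : C^o) : C).
  rewrite -(@zsum_shift _ (- 1) (fun n => beta e i' n * beta e j (k' - 1 - n) : C^o)).
  have nz f : bounded (f : int -> C^o) -> - zsum f = zsum (fun n => - f n).
    by move=> fb; rewrite (islin_zsum (h := (-%R : C^o -> C^o))) // => a x y; rewrite opprD scalerN.
  rewrite [X in _ - X]/(zsum _ : C^o) nz; last exact: beta_bounded.
  rewrite -zsumD.
  - apply: eq_zsum => n; rewrite beta_rec (_ : k' - 1 - (n + -1) = k' - n); last by ring.
    by rewrite mulrDl mulNr.
  - have [N hN] := beta_bounded e i' j (k' - 1).
    by exists (`|N| + 1) => n hn; apply: hN; lia.
  - have [N hN] := beta_bounded e i' j k'.
    by exists N => n /hN ->; rewrite oppr0.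
elim/int_bi_ind: i k => [|i IH|i IH] k.
- rewrite (@zsum1 _ 0) ?beta0 ?mul1r ?subr0 ?add0r // => n /negbTE n0.
  by rewrite beta0 n0 mul0r.
- by rewrite rec !IH addrAC beta_rec.
- pose f k := (zsum (fun n => beta e i n * beta e j (k - n) : C^o) : C) - beta e (i + j) k.
  have fc : forall k, f (k + 1) = f k.
    move=> k'; have := IH (k' + 1); rewrite rec [i + 1 + j]addrAC beta_rec addrK => h.
    move: h; rewrite /f; move: (zsum _ : C) (zsum _ : C) (beta _ _ _) (beta _ _ _) => x y z t.
    by move/eqP; rewrite subr_eq => /eqP ->; ring.
  suff [k0 fk0] : exists k0, f k0 = 0.
    by apply/eqP; rewrite -subr_eq0 -/(f k) (int_const fc k k0) fk0.
  exists (if e then `|i| + `|j| + 1 else -1); rewrite /f.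
  rewrite (beta_side (i := i + j)) ?subr0; last by case: (e); lia.
  rewrite -[RHS](zsum0 (C^o)); apply: eq_zsum => n; case: (e).
    case: (ltrP i n) => h; first by rewrite beta_side ?mul0r.
    by rewrite mulrC beta_side ?mul0r //; lia.
  case: (ltrP n 0) => h; first by rewrite beta_side ?mul0r.
  by rewrite mulrC beta_side ?mul0r //; lia.
Qed.

(** * Powers of the logarithm *)

Definition fps := nat -> C.
HB.instance Definition _ := GRing.Zmodule.copy fps (nat -> C).

Section FpsRing.
Implicit Types f g h : fps.

Definition fps_mul f g : fps := fun n => \sum_(i < n.+1) f i * g (n - i)%N.
Definition fps_one : fps := fun n => (n == 0)%:R.
Definition fps_trunc N f : {poly C} := \poly_(i < N) f i.

Lemma fps_mulE N f g n : (n < N)%N -> fps_mul f g n = (fps_trunc N f * fps_trunc N g)`_n.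
Proof.
move=> nN; rewrite coefM; apply: eq_bigr => i _.
by rewrite !coef_poly !ifT //; have := ltn_ord i; lia.
Qed.

Lemma fps_truncM N f g n : (n < N)%N ->
  (fps_trunc N (fps_mul f g))`_n = (fps_trunc N f * fps_trunc N g)`_n.
Proof. by move=> nN; rewrite coef_poly nN (fps_mulE _ _ nN). Qed.

Lemma fps_mulC : commutative fps_mul.
Proof. by move=> f g; apply/funext => n; rewrite !(fps_mulE _ _ (ltnSn n)) mulrC. Qed.

Lemma fps_mulA : associative fps_mul.
Proof.
have E f g h n : fps_mul (fps_mul f g) h n =
    (fps_trunc n.+1 f * fps_trunc n.+1 g * fps_trunc n.+1 h)`_n.
  rewrite (fps_mulE _ _ (ltnSn n)) !coefM; apply: eq_bigr => i _.
  by rewrite fps_truncM.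
move=> f g h; apply/funext => n.
by rewrite [LHS](congr1 (@^~ n) (fps_mulC f _)) !E; rewrite mulrC mulrA.
Qed.

Lemma fps_mul1 : left_id fps_one fps_mul.
Proof.
move=> f; apply/funext => n; rewrite /fps_mul big_ord_recl /= mul1r subn0 big1 ?addr0 //.
by move=> i _; rewrite mul0r.
Qed.

Lemma fps_mulDl : left_distributive fps_mul +%R.
Proof.
move=> f g h; apply/funext => n; rewrite -[RHS]/(fps_mul f h n + fps_mul g h n) /fps_mul
  -big_split /=.
by apply: eq_bigr => i _; rewrite -mulrDl.
Qed.

Lemma fps_one_neq0 : fps_one != 0 :> fps.
Proof. by apply/eqP => /(congr1 (@^~ 0%N)) /eqP; rewrite oner_eq0. Qed.

HB.instance Definition _ := GRing.Zmodule_isComNzRing.Build fps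
  fps_mulA fps_mulC fps_mul1 fps_mulDl fps_one_neq0.

Lemma coef_fpsM f g n : (f * g) n = \sum_(i < n.+1) f i * g (n - i)%N.
Proof. by []. Qed.
Lemma coef_fps1 n : (1 : fps) n = (n == 0)%:R.
Proof. by []. Qed.
Lemma coef_fpsD f g n : (f + g) n = f n + g n.
Proof. by []. Qed.
Lemma coef_fpsB f g n : (f - g) n = f n - g n.
Proof. by []. Qed.

Lemma coef_fpsX_lt f (k n : nat) : f 0%N = 0 -> (n < k)%N -> (f ^+ k) n = 0.
Proof.
move=> f0; elim: k n => [//|k IH] n nk; rewrite exprS coef_fpsM big1 // => i _.
case: (posnP i) => [->|i0]; first by rewrite f0 mul0r.
by rewrite IH ?mulr0 //; have := ltn_ord i; lia.
Qed.

Lemma coef_fps_sum (J : nat) (F : nat -> fps) n : (\sum_(k < J) F k) n = \sum_(k < J) F k n.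
Proof. by elim: J => [|J IH]; rewrite ?big_ord0 // !big_ord_recr /= -IH. Qed.

(* The geometric series in [1 - f]. *)
Lemma fps_inv f : f 0%N = 1 -> exists g, f * g = 1.
Proof.
move=> f0; pose u := 1 - f.
have u0 : u 0%N = 0 by rewrite /u coef_fpsB f0 coef_fps1 subrr.
have fE : f = 1 - u by rewrite /u; ring.
pose G N : fps := \sum_(k < N) u ^+ k.
have GE n N : (n < N)%N -> G N n = G n.+1 n.
  rewrite /G => nN; rewrite !coef_fps_sum -(subnKC nN) big_split_ord /=.
  rewrite [X in _ + X]big1 ?addr0 // => i _.
  by rewrite coef_fpsX_lt //; lia.
have fG N : f * G N = 1 - u ^+ N.
  elim: N => [|N IH]; first by rewrite /G big_ord0 mulr0 expr0 subrr.
  by rewrite /G big_ord_recr /= -/(G N) mulrDr IH fE exprS; ring.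
exists (fun n => G n.+1 n); apply/funext => n; rewrite coef_fpsM.
transitivity ((f * G n.+1) n).
  rewrite coef_fpsM; apply: eq_bigr => i _; congr (_ * _).
  by rewrite (GE (n - i)%N n.+1) // ltnS leq_subr.
by rewrite fG coef_fpsB coef_fpsX_lt // subr0.
Qed.

Definition theta f : fps := fun n => n%:R * f n.

Lemma thetaM f g : theta (f * g) = theta f * g + f * theta g.
Proof.
apply/funext => n; rewrite coef_fpsD !coef_fpsM /theta coef_fpsM mulr_sumr -big_split /=.
apply: eq_bigr => i _.
have -> : n%:R = i%:R + (n - i)%:R :> C by rewrite -natrD subnKC // -ltnS.
ring.
Qed.

Definition fps_X : fps := fun n => (n == 1)%:R.

Lemma coef_fpsXM f n : (fps_X * f) n = if n is m.+1 then f m else 0.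
Proof.
case: n => [|n]; first by rewrite coef_fpsM big_ord1 /fps_X mul0r.
rewrite coef_fpsM 2!big_ord_recl /= /fps_X /= mul0r mul1r add0r subn1 big1 ?addr0 //.
by move=> i _; rewrite mul0r.
Qed.

End FpsRing.

(* log (1 + X) / X *)
Definition logs : fps := fun n => (-1) ^+ n / n.+1%:R.

Lemma logs_inv_ex : exists g, logs * g = 1.
Proof. by apply: fps_inv; rewrite /logs expr0 divr1. Qed.

Definition logs_inv : fps := sval (cid logs_inv_ex).

Lemma logs_invE : logs * logs_inv = 1.
Proof. by rewrite /logs_inv; case: cid. Qed.

Definition logs_pow (n : int) : fps :=
  match n with Posz k => logs ^+ k | Negz k => logs_inv ^+ k.+1 end.

Lemma logs_powS n : logs_pow (n + 1) = logs * logs_pow n.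
Proof.
case: n => k; first by rewrite -PoszD addn1 /= exprS.
case: k => [|k]; first by rewrite (_ : _ + 1 = 0) //= expr1 logs_invE.
rewrite (_ : _ + 1 = Negz k); last lia.
by rewrite /= [logs_inv ^+ k.+2]exprS mulrA logs_invE mul1r.
Qed.

Lemma logs_reg (f g : fps) : logs * f = logs * g -> f = g.
Proof.
move=> /(congr1 (fun h => logs_inv * h)).
by rewrite !mulrA [logs_inv * _]mulrC logs_invE !mul1r.
Qed.

Lemma logs_powD n m : logs_pow (n + m) = logs_pow n * logs_pow m.
Proof.
elim/int_bi_ind: n => [|n IH|n IH]; first by rewrite add0r /= expr0 mul1r.
- by rewrite addrAC !logs_powS IH mulrA.
- by apply: logs_reg; rewrite mulrA -!logs_powS -IH addrAC.
Qed.

Lemma theta1 : theta 1 = 0.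
Proof. by apply/funext => -[|n]; rewrite /theta coef_fps1 ?mul0r ?mulr0. Qed.

Lemma theta_logs_pow n : logs * theta (logs_pow n) = n%:~R * logs_pow n * theta logs.
Proof.
elim/int_bi_ind: n => [|n IH|n IH]; first by rewrite /= expr0 theta1 mulr0 !mul0r.
- rewrite logs_powS thetaM mulrDr [X in _ + X]mulrCA IH intrD; ring.
- apply: logs_reg; move: IH; rewrite logs_powS thetaM mulrDr intrD.
  move/(congr1 (fun f => f - logs * logs_pow n * theta logs)) => h.
  transitivity (logs * (theta logs * logs_pow n) + logs * (logs * theta (logs_pow n))
    - logs * logs_pow n * theta logs); first by ring.
  by rewrite h; ring.
Qed.

Lemma logs_ode : (1 + fps_X) * (logs + theta logs) = 1.
Proof.
rewrite mulrDl mul1r; apply/funext => -[|n]; rewrite coef_fpsD coef_fpsXM !coef_fpsD /theta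
  /logs coef_fps1.
  by rewrite expr0 divr1 mul0r !addr0.
rewrite -[in n.+1 == 0%N]/false /= exprS.
have h1 := natCS_neq0 n; have h2 := natCS_neq0 n.+1.
have e1 : n.+2%:R = n.+1%:R + 1 :> C by rewrite natr1.
have e2 : n%:R = n.+1%:R - 1 :> C by rewrite -natr1 addrK.
move: h2; rewrite e1 e2; move: h1; move: (n.+1%:R) => x h1 h2.
by field; rewrite h1 h2.
Qed.

(* The coefficient of [s ^ i] in [log (1 + s) ^ n]. *)
Definition logc (n i : int) : C := if n <= i then logs_pow n (absz (i - n)) else 0.

Lemma logc_lt n i : i < n -> logc n i = 0.
Proof. by move=> h; rewrite /logc ifF //; lia. Qed.

Lemma logs_pow0 n : logs_pow n 0%N = 1.
Proof.
have c0 : logs 0%N = 1 by rewrite /logs expr0 divr1.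
have r m : logs_pow (m + 1) 0%N = logs_pow m 0%N.
  by rewrite logs_powS coef_fpsM big_ord1 subnn c0 mul1r.
by rewrite (int_const r n 0).
Qed.

Lemma logc_diag n : logc n n = 1.
Proof. by rewrite /logc lexx subrr logs_pow0. Qed.

Lemma logc0 i : logc 0 i = (i == 0)%:R.
Proof.
rewrite /logc /= expr0 subr0; case: i => i //=.
Qed.

Lemma logc_D n i : n%:~R * logc (n - 1) i = (i + 1)%:~R * logc n (i + 1) + i%:~R * logc n i.
Proof.
have key : n%:~R * logs_pow (n - 1) =
    (1 + fps_X) * (n%:~R * logs_pow n + theta (logs_pow n)).
  apply: logs_reg; rewrite mulrCA -logs_powS subrK mulrCA [logs * (_ + _)]mulrDr theta_logs_pow.
  transitivity ((1 + fps_X) * (logs + theta logs) * (n%:~R * logs_pow n)); last by ring.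
  by rewrite logs_ode mul1r.
have cz (f : fps) k : (n%:~R * f) k = n%:~R * f k.
  have -> : n%:~R * f = f *~ n by rewrite mulrzl.
  have -> : n%:~R * f k = f k *~ n by rewrite mulrzl.
  elim/int_bi_ind: n {key} => [//|m IH|m IH]; first by rewrite !mulrzDr coef_fpsD IH.
  by move: IH; rewrite !mulrzDr coef_fpsD => /addIr.
rewrite /logc; case: (ltrgtP (i + 1) n) => h.
- by rewrite !ifF ?mulr0 ?addr0 //; lia.
- rewrite !ifT; try lia.
  move: (congr1 (fun f : fps => f (absz (i - n)).+1) key).
  rewrite cz mulrDl mul1r coef_fpsD coef_fpsXM !coef_fpsD !cz /theta.
  rewrite (_ : absz (i - (n - 1))%R = (absz (i - n)).+1) => [->|]; last lia.
  rewrite (_ : absz (i + 1 - n)%R = (absz (i - n)).+1); last lia.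
  rewrite (_ : (i + 1)%:~R = n%:~R + (absz (i - n)).+1%:R); last first.
    by rewrite -[_.+1%:R]/((absz (i - n)).+1%:~R) -intrD; congr _%:~R; lia.
  rewrite (_ : i%:~R = n%:~R + (absz (i - n))%:R); last first.
    by rewrite -[(absz _)%:R]/((absz (i - n))%:~R) -intrD; congr _%:~R; lia.
  ring.
- rewrite -h (_ : (i + 1 <= i) = false); last lia.
  rewrite addrK lexx !subrr !logs_pow0; ring.
Qed.

Lemma logc_conv n m (k : int) :
  zsum (fun i => logc n i * logc m (k - i) : C^o) = logc (n + m) k.
Proof.
case: (ltrP k (n + m)) => h.
  rewrite logc_lt // -[RHS](zsum0 (C^o)); apply: eq_zsum => i.
  case: (ltrP i n) => hi; first by rewrite logc_lt ?mul0r.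
  by rewrite [logc m _]logc_lt ?mulr0 //; lia.
rewrite -(zsum_shift n) (@zsumE _ _ (absz (k - n - m)%R)); last first.
  move=> i hi; case: (ltrP i 0) => h0; first by rewrite logc_lt ?mul0r //; lia.
  by rewrite [logc m _]logc_lt ?mulr0 //; lia.
set N := absz _; rewrite -addnn -addnS big_split_ord /= big1 => [|i _]; last first.
  by rewrite logc_lt ?mul0r //; have := ltn_ord i; lia.
rewrite [in RHS]/logc h logs_powD coef_fpsM add0r (_ : absz _ = N); last lia.
apply: eq_bigr => i _; rewrite /logc !ifT; try by have := ltn_ord i; lia.
congr (logs_pow _ _ * logs_pow _ _); have := ltn_ord i; lia.
Qed.

Lemma zbinom_logc p i : \sum_(j < i.+1) (j`!%:R)^-1 * p%:~R ^+ j * logc j%:Z i%:Z = zbinom p i.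
Proof.
elim: i => [|i IH].
  by rewrite big_ord1 fact0 invr1 expr0 logc_diag zbinom0 !mulr1.
have h := natCS_neq0 i; rewrite zbinomS -IH; apply: (mulIf h); rewrite mulfVK //.
pose t (j i : nat) := (j`!%:R)^-1 * p%:~R ^+ j * logc j%:Z i%:Z.
rewrite -/(t 0 0); have E (j : nat) : t j.+1 i.+1 * i.+1%:R = p%:~R * t j i - i%:R * t j.+1 i.
  have e : i.+1%:R * logc j.+1%:Z i.+1%:Z = j.+1%:R * logc j%:Z i%:Z - i%:R * logc j.+1%:Z i%:Z.
    have := logc_D j.+1%:Z i%:Z.
    rewrite (_ : i%:Z + 1 = i.+1%:Z) 1?(_ : j.+1%:Z - 1 = j%:Z); try lia.
    by rewrite -!pmulrn => ->; rewrite addrK.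
  have h' := natCS_neq0 j.
  have f0 : j`!%:R != 0 :> C by rewrite pnatr_eq0 -lt0n fact_gt0.
  transitivity ((j.+1`!%:R)^-1 * p%:~R ^+ j.+1 * (i.+1%:R * logc j.+1%:Z i.+1%:Z)).
    by rewrite /t; ring.
  rewrite e /t factS natrM invfM exprS.
  by move: h' f0; move: (j.+1%:R) (j`!%:R) => x y h' f0; field; rewrite h' f0.
rewrite big_ord_recl /= logc0 mulr0 add0r mulr_suml.
rewrite (eq_bigr (fun j : 'I_i.+1 => p%:~R * t j i - i%:R * t j.+1 i)); last by move=> j _;
  rewrite -E.
rewrite sumrB -!mulr_sumr mulrBr [_ * p%:~R]mulrC [_ * i%:R]mulrC.
congr (_ - _); case: i {IH h E} => [|i]; first by rewrite !mul0r.
congr (_ * _); rewrite [RHS]big_ord_recl /= logc0 mulr0 add0r big_ord_recr /=.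
by rewrite [X in _ + X]/t logc_lt ?mulr0 ?addr0 //; lia.
Qed.

Lemma pchoice_bound (P : int -> int -> Prop) (k : nat) :
  (forall m, exists R, forall r, R < r -> P m r) ->
  exists R, forall m, (absz m <= k)%N -> forall r, R < r -> P m r.
Proof.
move=> h; elim: k => [|k [R hR]].
  by have [R hR] := h 0; exists R => m; rewrite leqn0 absz_eq0 => /eqP ->.
have [R1 h1] := h k.+1%:Z; have [R2 h2] := h (- k.+1%:Z).
exists (`|R| + `|R1| + `|R2|) => m; rewrite leq_eqVlt => /orP[/eqP e r hr|mk r hr].
  case: (lerP 0 m) => m0.
    by rewrite (_ : m = k.+1%:Z); [apply: h1; lia | lia].
  by rewrite (_ : m = - k.+1%:Z); [apply: h2; lia | lia].
by apply: hR; [lia | lia].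
Qed.

Lemma bounded2_row (U : lmodType C) (f : int -> int -> U) n : bounded2 f -> bounded (f n).
Proof. by move=> [N h]; exists N => r hr; apply: h; lia. Qed.

Lemma bounded2_zsum (U : lmodType C) (f : int -> int -> U) :
  bounded2 f -> bounded (fun n => zsum (f n)).
Proof.
move=> [N h]; exists N => n hn; rewrite -[RHS](zsum0 U); apply: eq_zsum => r.
by apply: h; lia.
Qed.

Lemma zsumB (U : lmodType C) (f g : int -> U) : bounded f -> bounded g ->
  zsum (fun i => f i - g i) = zsum f - zsum g.
Proof.
move=> fb gb; rewrite zsumD //.
  by congr (_ + _); rewrite (islin_zsum (h := -%R)) // => a x y; rewrite opprD scalerN.
by have [N h] := gb; exists N => i /h ->; rewrite oppr0.
Qed.

(* [Dop] is dual to the derivation [xi d/dxi], which sends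
   [s ^ k] to [k (s ^ k + s ^ (k - 1))] for [s = xi - 1]. *)
Definition Dop (U : lmodType C) (y : int -> U) (k : int) : U :=
  k%:~R *: (y k + y (k - 1)).

Lemma iter_DopB (U : lmodType C) (y z : int -> U) l j :
  iter l (@Dop U) (fun k => y k - z k) j = iter l (@Dop U) y j - iter l (@Dop U) z j.
Proof.
elim: l j => [|l IH] j //=; rewrite /Dop !IH -scalerBr; congr (_ *: _).
by rewrite opprD addrACA.
Qed.

Lemma beta_moment e i j l r :
  zsum (fun n => n%:~R ^+ l * (beta e j n * beta e i (r - n)) : C^o)
  = iter l (@Dop _) (fun k => beta e (i + k) r : C^o) j.
Proof.
elim: l j => [|l IH] j /=.
  by rewrite addrC -beta_conv; apply: eq_zsum => n; rewrite mul1r.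
have bd k : bounded (fun n => n%:~R ^+ l * (beta e k n * beta e i (r - n)) : C^o).
  by have [N h] := beta_bounded e k i r; exists N => n /h ->; rewrite mulr0.
rewrite /Dop -!IH -zsumD // -zsumZ; last exact: boundedD.
apply: eq_zsum => n; rewrite -mulrDr -mulrDl.
rewrite exprSr -mulrA [n%:~R * _]mulrA beta_D.
rewrite -[j%:~R *: _]/(j%:~R * _); ring.
Qed.

Lemma iter_Dop_zsum (U : lmodType C) (x : int -> int -> C) (g : int -> U) l j :
  (forall k, bounded (fun r => x k r *: g r)) ->
  bounded (fun r => (iter l (@Dop _) (fun k => x k r : C^o) j : C) *: g r) /\
  iter l (@Dop U) (fun k => zsum (fun r => x k r *: g r)) j
  = zsum (fun r => (iter l (@Dop _) (fun k => x k r : C^o) j : C) *: g r).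
Proof.
move=> bd; elim: l j => [|l IH] j //=.
have [b1 e1] := IH j; have [b2 e2] := IH (j - 1).
have E r : (Dop (iter l (@Dop _) (fun k => x k r : C^o)) j : C) *: g r =
   j%:~R *: ((iter l (@Dop _) (fun k => x k r : C^o) j : C) *: g r
             + (iter l (@Dop _) (fun k => x k r : C^o) (j - 1) : C) *: g r).
  by rewrite -scalerDl scalerA.
have bb := boundedD b1 b2.
split; first by have [N h] := bb; exists N => r /h h0; rewrite E h0 scaler0.
by rewrite /Dop e1 e2 -zsumD // -zsumZ //; apply: eq_zsum => r; rewrite -E.
Qed.

Lemma beta_double_sum (U : lmodType C) e i j p (J : nat) (G : int -> int -> U)
    (g : nat -> int -> U) (R : nat -> int) :
  (forall n m, G n m = \sum_(l < J) ((l`!%:R)^-1 * n%:~R ^+ l) *: g l (n + m)) ->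
  (forall l r, (if e then r < R l else R l < r) -> g l r = 0) ->
  zsum (fun n => zsum (fun m => (beta e j n * beta e i (m - p)) *: G n m)) =
  \sum_(l < J) (l`!%:R)^-1 *:
     iter l (@Dop U) (fun k => zsum (fun r => beta e (i + k) (r - p) *: g l r)) j.
Proof.
move=> GE g0.
have sd l : bounded2 (fun n r => ((l`!%:R)^-1 * (n%:~R ^+ l * (beta e j n * beta e i (r - p -
  n)))) *: g l r).
  exists (`|i| + `|j| + `|p| + `|R l|) => n r hnr.
  case: (boolP (if e then r < R l else R l < r)) => hr; first by rewrite g0 ?scaler0.
  case: (boolP (if e then j < n else n < 0)) => hn.
    by rewrite (beta_side hn) mul0r !mulr0 scale0r.
  rewrite [beta e i _]beta_side ?mulr0 ?scale0r //.
  by case: (e) hr hn; lia.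
have bd l k : bounded (fun r => beta e (i + k) (r - p) *: g l r).
  apply: (@bounded_range _ (- (`|i| + `|k| + `|p| + `|R l|)) (`|i| + `|k| + `|p| + `|R l|)) => r hr.
  case: (boolP (if e then r < R l else R l < r)) => hr'; first by rewrite g0 ?scaler0.
  by rewrite beta_side ?scale0r //; case: (e) hr'; lia.
transitivity (zsum (fun n => zsum (fun r => \sum_(l < J)
   ((l`!%:R)^-1 * (n%:~R ^+ l * (beta e j n * beta e i (r - p - n)))) *: g l r))).
  apply: eq_zsum => n; rewrite -(zsum_shift (- n)); apply: eq_zsum => r.
  rewrite GE scaler_sumr; apply: eq_bigr => l _.
  rewrite scalerA [n + _]addrC subrK; congr (_ *: _).
  by rewrite (_ : r - n - p = r - p - n); [ring | ring].
pose F l n r := ((l`!%:R)^-1 * (n%:~R ^+ l * (beta e j n * beta e i (r - p - n)))) *: g l r.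
transitivity (\sum_(l < J) zsum (fun n => zsum (F l n))).
  rewrite -(@zsum_sum _ J (fun l n => zsum (F l n))) => [|l _]; last exact: bounded2_zsum (sd l).
  apply: eq_zsum => n; rewrite -(@zsum_sum _ J (fun l r => F l n r)) // => l _.
  exact: bounded2_row (sd l).
apply: eq_bigr => l _; rewrite zsum_exchange; last exact: sd.
have [b ->] := iter_Dop_zsum l j (bd l).
rewrite -zsumZ //; apply: eq_zsum => r.
have bz : bounded (fun n => n%:~R ^+ l * (beta e j n * beta e i (r - p - n)) : C^o).
  by have [N h] := beta_bounded e j i (r - p); exists N => n /h ->; rewrite mulr0.
rewrite -beta_moment -zsum_scalel // -zsumZ.
  by apply: eq_zsum => n; rewrite scalerA.
by have [N h] := bz; exists N => n /h ->; rewrite scale0r.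
Qed.

(** * Residue products of fields *)

Section Fields.
Variable W : lmodType C.
Implicit Types (a c d : int -> W -> W) (w : W) (i j k n m p t N : int) (e : bool).

(* [c n] is the coefficient of [x ^ n] of the field [c]. *)
Definition is_field c :=
  (forall n, islin (c n)) /\ (forall w, exists N, forall n, n < N -> c n w = 0).

Lemma field_lin c n : is_field c -> islin (c n).
Proof. by case. Qed.

Lemma field_lb c w : is_field c -> exists N, forall n, n < N -> c n w = 0.
Proof. by case. Qed.

Definition ordered e c d n m w : W := if e then c n (d m w) else d m (c n w).

(* The coefficient of [x2 ^ t] in the residue at [oo] ([e = true]) or at [0] of
   [xi ^ p (xi - 1) ^ i] times [c(x1) d(x2)], respectively [d(x2) c(x1)], [xi = x1 / x2]. *)
Definition half_res e p i c d t w : W :=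
  zsum (fun n => beta e i (n - p) *: ordered e c d (- n) (t + n) w).

Definition rprod p i c d t w : W := half_res true p i c d t w - half_res false p i c d t w.

Lemma ordered_lin e c d n m : is_field c -> is_field d -> islin (ordered e c d n m).
Proof.
move=> [cl _] [dl _] a x y; rewrite /ordered; case: e.
  by rewrite (dl m a) (cl n a).
by rewrite (cl n a) (dl m a).
Qed.

Lemma ordered_vanish e c d t w : is_field c -> is_field d ->
  exists R, forall r, (if e then r < R else R < r) -> ordered e c d (- r) (t + r) w = 0.
Proof.
move=> cf df; case: e; rewrite /ordered.
  have [N hN] := field_lb w df; exists (N - t) => r hr.
  by rewrite hN ?islin0 //; [exact: field_lin | lia].
have [N hN] := field_lb w cf; exists (- N) => r hr.
by rewrite hN ?islin0 //; [exact: field_lin | lia].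
Qed.

Lemma half_res_bounded e p i c d t w : is_field c -> is_field d ->
  bounded (fun n => beta e i (n - p) *: ordered e c d (- n) (t + n) w).
Proof.
move=> cf df; have [R hR] := ordered_vanish e t w cf df.
exists (`|i| + `|p| + `|R|) => n hn.
case: (boolP (if e then n < R else R < n)) => hr; first by rewrite hR ?scaler0.
by rewrite beta_side ?scale0r //; case: (e) hr; lia.
Qed.

Lemma half_res_rec e p i c d t w : is_field c -> is_field d ->
  half_res e (p + 1) i c d t w - half_res e p i c d t w = half_res e p (i + 1) c d t w.
Proof.
move=> cf df; rewrite /half_res -zsumB; try exact: half_res_bounded.
apply: eq_zsum => n; rewrite -scalerBl beta_rec; congr ((beta _ _ _ - _) *: _); ring.
Qed.

Lemma rprod_rec p i c d t w : is_field c -> is_field d ->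
  rprod (p + 1) i c d t w - rprod p i c d t w = rprod p (i + 1) c d t w.
Proof.
move=> cf df; rewrite /rprod -(half_res_rec true) // -(half_res_rec false) //.
by rewrite !opprD !opprK addrACA.
Qed.

Lemma half_res_islin e p i c d t : is_field c -> is_field d -> islin (half_res e p i c d t).
Proof.
move=> cf df b x y; rewrite /half_res.
have hb w := half_res_bounded e p i t w cf df.
rewrite -zsumZ // -zsumD //; last exact: bounded_scale.
by apply: eq_zsum => n; rewrite ordered_lin // scalerDr !scalerA mulrC.
Qed.

Lemma half_res_lb e p i c d w : is_field c -> is_field d ->
  exists N, forall t, t < N -> half_res e p i c d t w = 0.
Proof.
move=> cf df; rewrite /half_res; case: e.
  have [N hN] := field_lb w df; exists (N - i - p) => t ht.
  rewrite -[RHS](zsum0 W); apply: eq_zsum => n.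
  case: (ltrP i (n - p)) => h; first by rewrite beta_side ?scale0r.
  rewrite /ordered hN; last by lia.
  by rewrite islin0 ?scaler0 //; exact: field_lin.
have [N hN] := field_lb w cf.
have : exists R, forall n, (absz n <= absz p + absz N)%N -> forall r, R < r ->
  d (- r) (c (- n) w) = 0.
  apply: pchoice_bound => n; have [R hR] := field_lb (c (- n) w) df.
  by exists (- R) => r hr; apply: hR; lia.
move=> [R hR]; exists (- `|R| - (`|p| + `|N|)) => t ht.
rewrite -[RHS](zsum0 W); apply: eq_zsum => n.
case: (ltrP n p) => h; first by rewrite beta_side ?scale0r //; lia.
rewrite /ordered; case: (ltrP (- n) N) => hn.
  by rewrite hN // islin0 ?scaler0 //; exact: field_lin.
by rewrite -[t + n]opprK hR ?scaler0 //; lia.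
Qed.

Lemma half_res_field e p i c d : is_field c -> is_field d -> is_field (half_res e p i c d).
Proof. by move=> cf df; split=> [n|w]; [exact: half_res_islin | exact: half_res_lb]. Qed.

Lemma field_comb (b : C) c d : is_field c -> is_field d ->
  is_field (fun n w => b *: c n w + d n w).
Proof.
move=> [cl cb] [dl db]; split=> [n a x y|w].
  by rewrite cl dl !scalerDr !scalerA addrACA mulrC.
have [N hN] := cb w; have [M hM] := db w.
by exists (- (`|N| + `|M|)) => n hn; rewrite hN ?hM ?scaler0 ?addr0 //; lia.
Qed.

Lemma rprod_field p i c d : is_field c -> is_field d -> is_field (rprod p i c d).
Proof.
move=> cf df; have := field_comb (-1) (half_res_field false p i cf df) (half_res_field true p i
  cf df).
rewrite (_ : (fun n w => _) = rprod p i c d) //.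
by apply/funext => n; apply/funext => w; rewrite scaleN1r addrC.
Qed.

Lemma rprod_linr p i c b d d' t w : is_field c -> is_field d -> is_field d' ->
  rprod p i c (fun n w => b *: d n w + d' n w) t w
  = b *: rprod p i c d t w + rprod p i c d' t w.
Proof.
move=> cf df df'; rewrite /rprod scalerBr addrACA -opprD.
have E e : half_res e p i c (fun n w => b *: d n w + d' n w) t w
    = b *: half_res e p i c d t w + half_res e p i c d' t w.
  rewrite /half_res -zsumZ; last exact: half_res_bounded.
  rewrite -zsumD; last exact: half_res_bounded.
  - apply: eq_zsum => n; rewrite scalerA mulrC -scalerA -scalerDr; congr (_ *: _).
    by rewrite /ordered; case: e => //; rewrite (proj1 cf).
  - by apply: bounded_scale; exact: half_res_bounded.
by rewrite !E.
Qed.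

Lemma rprod_linl p i b c c' d t w : is_field c -> is_field c' -> is_field d ->
  rprod p i (fun n w => b *: c n w + c' n w) d t w
  = b *: rprod p i c d t w + rprod p i c' d t w.
Proof.
move=> cf cf' df; rewrite /rprod scalerBr addrACA -opprD.
have E e : half_res e p i (fun n w => b *: c n w + c' n w) d t w
    = b *: half_res e p i c d t w + half_res e p i c' d t w.
  rewrite /half_res -zsumZ; last exact: half_res_bounded.
  rewrite -zsumD; last exact: half_res_bounded.
  - apply: eq_zsum => n; rewrite scalerA mulrC -scalerA -scalerDr; congr (_ *: _).
    by rewrite /ordered; case: e => //; rewrite (proj1 df).
  - by apply: bounded_scale; exact: half_res_bounded.
by rewrite !E.
Qed.

(* [(x1 - x2) ^ N [c(x1), d(x2)] = 0]. *)
Definition loc N c d := forall p t w, rprod p N c d t w = 0.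

Lemma locS N c d : is_field c -> is_field d -> loc N c d -> loc (N + 1) c d.
Proof. by move=> cf df h p t w; rewrite -rprod_rec // !h subrr. Qed.

Lemma loc_le N M c d : is_field c -> is_field d -> loc N c d -> N <= M -> loc M c d.
Proof.
move=> cf df h NM; rewrite (_ : M = N + (absz (M - N))%:Z); last lia.
elim: (absz _) => [|n IH]; first by rewrite addr0.
by rewrite -addn1 PoszD addrA; apply: locS.
Qed.

Definition ordered2 e1 e2 a c d t w n m : W :=
  if e1 then a (- n) (ordered e2 c d (- m) (t + n + m) w)
  else ordered e2 c d (- m) (t + n + m) (a (- n) w).

Lemma ordered2_bounded2 e1 e2 a c d j q i p t w :
  is_field a -> is_field c -> is_field d ->
  bounded2 (fun n m => (beta e1 j (n - q) * beta e2 i (m - p)) *: ordered2 e1 e2 a c d t w n m).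
Proof.
move=> af cf df.
have l0 f n : is_field f -> f n 0 = 0 by move=> ff; rewrite islin0 //; exact: field_lin.
have red (K : int) : (forall n m, [|| n < - K, K < n, m < - K | K < m] ->
    (if e1 then n <= j + q else q <= n) -> (if e2 then m <= i + p else p <= m) ->
    ordered2 e1 e2 a c d t w n m = 0) ->
  bounded2 (fun n m => (beta e1 j (n - q) * beta e2 i (m - p)) *: ordered2 e1 e2 a c d t w n m).
  move=> h; exists K => n m nm.
  case: (boolP (if e1 then n <= j + q else q <= n)) => h1; last first.
    by rewrite beta_side ?mul0r ?scale0r //; case: (e1) h1; lia.
  case: (boolP (if e2 then m <= i + p else p <= m)) => h2; last first.
    by rewrite (beta_side (e := e2)) ?mulr0 ?scale0r //; case: (e2) h2; lia.
  by rewrite h ?scaler0.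
have [Na hNa] := field_lb w af; have [Nc hNc] := field_lb w cf.
have [Nd hNd] := field_lb w df.
rewrite /ordered2 /ordered in red *; case: e1 e2 red => -[] red.
- apply: (red (`|Nd| + `|t| + `|j + q| + `|i + p|)) => n m nm h1 h2.
  by rewrite hNd ?l0 //; lia.
- have [|R hR] := @pchoice_bound (fun m r => d (t - r + m) (c (- m) w) = 0) (absz p + absz Nc).
    move=> m; have [R hR] := field_lb (c (- m) w) df.
    by exists (t + m - R) => r hr; apply: hR; lia.
  apply: (red (`|p| + `|Nc| + `|R| + `|j + q|)) => n m nm h1 h2.
  case: (ltrP (- m) Nc) => hm; first by rewrite hNc ?l0.
  by rewrite -[n]opprK hR ?l0 //; lia.
- have [|R hR] := @pchoice_bound (fun n r => d (t + n - r) (a (- n) w) = 0) (absz q + absz Na).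
    move=> n; have [R hR] := field_lb (a (- n) w) df.
    by exists (t + n - R) => r hr; apply: hR; lia.
  apply: (red (`|q| + `|Na| + `|R| + `|i + p|)) => n m nm h1 h2.
  case: (ltrP (- n) Na) => hn; first by rewrite hNa ?l0.
  by rewrite -[m]opprK hR ?l0 //; lia.
- have [|R hR] := @pchoice_bound (fun n r => c (- r) (a (- n) w) = 0) (absz q + absz Na).
    move=> n; have [R hR] := field_lb (a (- n) w) cf.
    by exists (- R) => r hr; apply: hR; lia.
  apply: (red (`|q| + `|Na| + `|R| + `|p|)) => n m nm h1 h2.
  case: (ltrP (- n) Na) => hn; first by rewrite hNa ?l0.
  by rewrite hR ?l0 //; lia.
Qed.

Lemma half_res_half e1 e2 a c d j q i p t w : is_field a -> is_field c -> is_field d ->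
  half_res e1 q j a (half_res e2 p i c d) t w =
  zsum (fun n => zsum (fun m => (beta e1 j (n - q) * beta e2 i (m - p)) *:
    ordered2 e1 e2 a c d t w n m)).
Proof.
move=> af cf df; apply: eq_zsum => n.
have hb w' := half_res_bounded e2 p i (t + n) w' cf df.
rewrite {1}/ordered /ordered2; case: e1.
  rewrite [half_res _ _ _ _ _ _ _]/half_res islin_zsum //; last exact: field_lin.
  rewrite -zsumZ.
    by apply: eq_zsum => m; rewrite islinZ ?scalerA //; exact: field_lin.
  by have [N h] := hb w; exists N => m /h ->; rewrite islin0 //; exact: field_lin.
by rewrite /half_res -zsumZ //; apply: eq_zsum => m; rewrite scalerA.
Qed.

Lemma rprod_prod a c d j q i p t w : is_field a -> is_field c -> is_field d ->
  rprod q j a (rprod p i c d) t w =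
  (half_res true q j a (half_res true p i c d) t w - half_res true q j a (half_res false p i c
    d) t w)
  - (half_res false q j a (half_res true p i c d) t w - half_res false q j a (half_res false p
    i c d) t w).
Proof.
move=> af cf df.
have E e : half_res e q j a (rprod p i c d) t w
    = half_res e q j a (half_res true p i c d) t w - half_res e q j a (half_res false p i c d) t w.
  have hb e' := half_res_bounded e q j t w af (half_res_field e' p i cf df).
  rewrite /half_res -zsumB; [|exact: (hb true)|exact: (hb false)].
  apply: eq_zsum => n; rewrite -scalerBr; congr (_ *: _).
  by rewrite /ordered; case: e {hb} => //; rewrite -islinB //; exact: field_lin.
by rewrite [LHS]/rprod !E.
Qed.

Lemma rprod_comm a c d (J : nat) (cl : nat -> int -> W -> W) j i p t w :
  is_field a -> is_field c -> is_field d -> (forall l, is_field (cl l)) ->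
  (forall q r w, a (- q) (c (- r) w) - c (- r) (a (- q) w)
     = \sum_(l < J) ((l`!%:R)^-1 * q%:~R ^+ l) *: cl l (- (q + r)) w) ->
  rprod 0 j a (rprod p i c d) t w - rprod p i c (rprod 0 j a d) t w =
  \sum_(l < J) (l`!%:R)^-1 *: iter l (@Dop W) (fun k => rprod p (i + k) (cl l) d t w) j.
Proof.
move=> af cf df clf comm.
pose co e1 e2 n m := beta e1 j n * beta e2 i (m - p).
have A e1 e2 : half_res e1 0 j a (half_res e2 p i c d) t w =
    zsum (fun n => zsum (fun m => co e1 e2 n m *: ordered2 e1 e2 a c d t w n m)).
  by rewrite half_res_half //; apply: eq_zsum => n; apply: eq_zsum => m; rewrite subr0.
have Ab e1 e2 : bounded2 (fun n m => co e1 e2 n m *: ordered2 e1 e2 a c d t w n m).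
  have [N h] := ordered2_bounded2 e1 e2 j 0 i p t w af cf df.
  by exists N => n m /h; rewrite subr0.
have Bb e1 e2 : bounded2 (fun n m => co e1 e2 n m *: ordered2 e2 e1 c a d t w m n).
  have [N h] := ordered2_bounded2 e2 e1 i p j 0 t w cf af df.
  exists N => n m nm; rewrite -[RHS](h m n); first by rewrite subr0 mulrC.
  by lia.
have B e1 e2 : half_res e2 p i c (half_res e1 0 j a d) t w =
    zsum (fun n => zsum (fun m => co e1 e2 n m *: ordered2 e2 e1 c a d t w m n)).
  rewrite half_res_half // [RHS]zsum_exchange; last exact: Bb.
  by apply: eq_zsum => n; apply: eq_zsum => m; rewrite subr0 mulrC.
have tC n m : t + n + m = t + m + n by rewrite addrAC.
have mix e : half_res e 0 j a (half_res (~~ e) p i c d) t w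
    = half_res (~~ e) p i c (half_res e 0 j a d) t w.
  rewrite A B; apply: eq_zsum => n; apply: eq_zsum => m; congr (_ *: _).
  by rewrite /ordered2 /ordered tC; case: (e).
pose S e := \sum_(l < J) (l`!%:R)^-1 *:
  iter l (@Dop W) (fun k => half_res e p (i + k) (cl l) d t w) j.
have SE e (X : int -> int -> W) : (forall n m, X n m = \sum_(l < J) ((l`!%:R)^-1 * n%:~R ^+ l) *:
      ordered e (cl l) d (- (n + m)) (t + (n + m)) w) ->
    zsum (fun n => zsum (fun m => co e e n m *: X n m)) = S e.
  have /choice [R hR] : forall l, exists R, forall r, (if e then r < R else R < r) ->
      ordered e (cl l) d (- r) (t + r) w = 0.
    by move=> l; exact: ordered_vanish.
  by move=> h; rewrite /S -(beta_double_sum i j p h hR).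
have sub e1 e2 (X Y : int -> int -> W) :
    bounded2 (fun n m => co e1 e2 n m *: X n m) -> bounded2 (fun n m => co e1 e2 n m *: Y n m) ->
    zsum (fun n => zsum (fun m => co e1 e2 n m *: X n m))
    - zsum (fun n => zsum (fun m => co e1 e2 n m *: Y n m))
    = zsum (fun n => zsum (fun m => co e1 e2 n m *: (X n m - Y n m))).
  move=> bX bY; rewrite -zsumB; try exact: bounded2_zsum.
  apply: eq_zsum => n; rewrite -zsumB; [|exact: (bounded2_row n bX)|exact: (bounded2_row n bY)].
  by apply: eq_zsum => m; rewrite scalerBr.
have sT : half_res true 0 j a (half_res true p i c d) t w - half_res true p i c (half_res true
  0 j a d) t w = S true.
  rewrite A B sub //; apply: SE => n m.
  rewrite /ordered2 /ordered (tC n m) comm.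
  by apply: eq_bigr => l _; rewrite -(tC n m) addrA.
have sF : half_res false p i c (half_res false 0 j a d) t w - half_res false 0 j a (half_res
  false p i c d) t w = S false.
  rewrite A B sub //; apply: SE => n m.
  rewrite /ordered2 /ordered (tC n m) -islinB; last exact: field_lin.
  rewrite comm islin_sum; last exact: field_lin.
  apply: eq_bigr => l _; rewrite islinZ; last exact: field_lin.
  by rewrite -(tC n m) addrA.
rewrite !rprod_prod // (mix true) -(mix false) /=.
transitivity (S true - S false).
  rewrite -sT -sF.
  have cancel_mixed (x1 x2 x3 x4 x5 x6 : W) :
      x1 - x2 - (x3 - x4) - (x5 - x3 - (x2 - x6)) = x1 - x5 - (x6 - x4).
    rewrite !(opprB, opprD) !addrA.
    by rewrite (ACl (1*8*3*6*(5*2)*(7*4)))%AC /= !subrr !addr0.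
  exact: cancel_mixed.
rewrite /S -sumrB; apply: eq_bigr => l _; rewrite -scalerBr; congr (_ *: _).
by rewrite iter_DopB.
Qed.

End Fields.

(** * Products with powers of [z] *)

Section LogSubstitution.
Variable U : lmodType C.
Implicit Types (y z : int -> U) (n m i k N : int).

Definition vanish_from N y := forall i, N <= i -> y i = 0.

(* If [y i] is the value of a linear functional at [s ^ i], then [zact n y]
   is its value at [z ^ n], where [z = log (1 + s)]. *)
Definition zact n y : U := zsum (fun i => logc n i *: y i).

Lemma zact_bounded n y N : vanish_from N y -> bounded (fun i => logc n i *: y i).
Proof.
move=> h; apply: (@bounded_range _ n N) => i hi.
case: (ltrP i n) => hn; first by rewrite logc_lt ?scale0r.
by rewrite h ?scaler0 //; lia.
Qed.

Lemma eq_zact n y z : (forall i, y i = z i) -> zact n y = zact n z.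
Proof. by move=> yz; apply: eq_zsum => i; rewrite yz. Qed.

Lemma zact_vanish n y N : vanish_from N y -> N <= n -> zact n y = 0.
Proof.
move=> h hn; rewrite -[RHS](zsum0 U); apply: eq_zsum => i.
case: (ltrP i n) => hi; first by rewrite logc_lt ?scale0r.
by rewrite h ?scaler0 //; lia.
Qed.

Lemma zact_fin n y N (k : nat) : vanish_from N y -> N <= n + k%:Z ->
  zact n y = \sum_(i < k) logc n (n + i%:Z) *: y (n + i%:Z).
Proof.
move=> h hk; rewrite /zact (@zsum_range _ n k) // => i hi.
case: (ltrP i n) => hi0; first by rewrite logc_lt ?scale0r //; lia.
by rewrite h ?scaler0 //; lia.
Qed.

Lemma zact_lin n (b : C) y z N : vanish_from N y -> vanish_from N z ->
  zact n (fun i => b *: y i + z i) = b *: zact n y + zact n z.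
Proof.
move=> hy hz; rewrite /zact -zsumZ; last exact: zact_bounded hy.
rewrite -zsumD; [|by apply: bounded_scale; exact: zact_bounded hy|exact: zact_bounded hz].
by apply: eq_zsum => i; rewrite scalerDr !scalerA mulrC.
Qed.

Lemma zactZ n (b : C) y N : vanish_from N y -> zact n (fun i => b *: y i) = b *: zact n y.
Proof.
move=> hy; rewrite /zact -zsumZ; last exact: zact_bounded hy.
by apply: eq_zsum => i; rewrite !scalerA mulrC.
Qed.

Lemma zact_sum (J : nat) n (y : nat -> int -> U) :
  (forall l, (l < J)%N -> exists N, vanish_from N (y l)) ->
  zact n (fun i => \sum_(l < J) y l i) = \sum_(l < J) zact n (y l).
Proof.
move=> hy; rewrite /zact -(@zsum_sum _ J (fun l i => logc n i *: y l i)).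
  by apply: eq_zsum => i; rewrite scaler_sumr.
by move=> l lJ; have [N hN] := hy l lJ; exact: zact_bounded hN.
Qed.

Lemma vanish_Dop N y : vanish_from N y -> vanish_from (N + 1) (Dop y).
Proof. by move=> h i hi; rewrite /Dop !h ?addr0 ?scaler0 //; lia. Qed.

Lemma vanish_iter_Dop N y l : vanish_from N y -> vanish_from (N + l%:Z) (iter l (@Dop U) y).
Proof.
elim: l => [|l IH] h; first by rewrite addr0.
by rewrite /= -addn1 PoszD addrA; apply: vanish_Dop; exact: IH.
Qed.

Lemma zact_Dop n y N : vanish_from N y -> zact n (Dop y) = n%:~R *: zact (n - 1) y.
Proof.
move=> h; have hs : vanish_from (N + 1) (fun i => y (i - 1)) by move=> i hi; apply: h; lia.
have hb : bounded (fun i => (logc n i * i%:~R) *: y i).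
  by have [M hM] := zact_bounded n h; exists M => i /hM e; rewrite mulrC -scalerA e scaler0.
have hb' : bounded (fun i => (logc n (i + 1) * (i + 1)%:~R) *: y i).
  apply: (@bounded_range _ (n - 1) N) => i hi.
  case: (ltrP (i + 1) n) => hn; first by rewrite logc_lt ?mul0r ?scale0r.
  by rewrite h ?scaler0 //; lia.
transitivity (zsum (fun i => (logc n i * i%:~R) *: y i)
   + zsum (fun i => (logc n i * i%:~R) *: y (i - 1))).
  rewrite -zsumD //.
    by apply: eq_zsum => i; rewrite /Dop scalerA scalerDr.
  have [M hM] := hb'; exists (`|M| + 1) => i hi.
  have /= := hM (i - 1); rewrite subrK; apply; lia.
rewrite -(zsum_shift 1 (fun i => _ *: y (i - 1))) -zsumD //; last first.
  by have [M hM] := hb'; exists M => i /hM; rewrite addrK.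
rewrite -zsumZ; last exact: zact_bounded h.
by apply: eq_zsum => i; rewrite addrK -scalerDl scalerA logc_D; congr (_ *: _); ring.
Qed.

Lemma zact_iter_Dop n y N l : vanish_from N y ->
  (l`!%:R)^-1 *: zact n (iter l (@Dop U) y) = zbinom n l *: zact (n - l%:Z) y.
Proof.
elim: l y N => [|l IH] y N h; first by rewrite fact0 invr1 zbinom0 subr0.
rewrite iterSr factS natrM invfM -scalerA (IH _ _ (vanish_Dop h)) (zact_Dop _ h).
rewrite !scalerA zbinomS intrB (_ : n - l%:Z - 1 = n - l.+1%:Z); last lia.
by rewrite -pmulrn; congr (_ *: _); ring.
Qed.

Lemma zact_zact n m y N : vanish_from N y ->
  zact n (fun i => zact m (fun k => y (i + k))) = zact (n + m) y.
Proof.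
move=> h; pose F i r := (logc n i * logc m (r - i)) *: y r.
have Fb : bounded2 F.
  exists (`|n| + `|m| + `|N|) => i r hir; rewrite /F.
  case: (ltrP i n) => hi; first by rewrite logc_lt ?mul0r ?scale0r.
  case: (ltrP (r - i) m) => hr; first by rewrite (logc_lt hr) mulr0 scale0r.
  by rewrite h ?scaler0 //; lia.
transitivity (zsum (fun i => zsum (F i))).
  apply: eq_zsum => i; rewrite /zact -(zsum_shift (- i)) -zsumZ.
    by apply: eq_zsum => r; rewrite scalerA (_ : i + (r - i) = r) //; ring.
  apply: (@bounded_range _ (m + i) N) => r hr.
  case: (ltrP (r - i) m) => hr'; first by rewrite logc_lt // scale0r.
  by rewrite h ?scaler0 //; lia.
rewrite zsum_exchange //; apply: eq_zsum => r.
rewrite -logc_conv -zsum_scalel //.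
apply: (@bounded_range _ n (r - m)) => i hi.
case: (ltrP i n) => hi'; first by rewrite logc_lt ?mul0r.
by rewrite [logc m _]logc_lt ?mulr0 //; lia.
Qed.

(* The identity [exp (q z) = (1 + s) ^ q], paired with [y]. *)
Lemma zact_exp q y (N : nat) : vanish_from N%:Z y ->
  \sum_(j < N) ((j`!%:R)^-1 * q%:~R ^+ j) *: zact j%:Z y = \sum_(i < N) zbinom q i *: y i%:Z.
Proof.
move=> h.
have E (j : nat) : (j < N)%N -> zact j%:Z y = \sum_(i < N) logc j%:Z i%:Z *: y i%:Z.
  move=> jN; rewrite (@zact_fin _ _ N%:Z (N - j)%N) //; last by lia.
  have e : N = (j + (N - j))%N by rewrite subnKC // ltnW.
  rewrite [in RHS]e big_split_ord /= [X in _ = X + _]big1 ?add0r.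
    by apply: eq_bigr => i _; rewrite PoszD.
  by move=> i _; rewrite logc_lt ?scale0r //; have := ltn_ord i; lia.
have D (i : nat) : (i < N)%N -> \sum_(j < N) ((j`!%:R)^-1 * q%:~R ^+ j) *:
    (logc j%:Z i%:Z *: y i%:Z) = zbinom q i *: y i%:Z.
  move=> iN; have e : N = (i.+1 + (N - i.+1))%N by rewrite subnKC.
  rewrite -zbinom_logc scaler_suml e big_split_ord /= [X in _ + X]big1 ?addr0.
    by apply: eq_bigr => j _; rewrite scalerA.
  by move=> j _; rewrite [logc _ _]logc_lt ?scale0r ?scaler0 //; lia.
rewrite (eq_bigr (fun j : 'I_N => \sum_(i < N) ((j`!%:R)^-1 * q%:~R ^+ j) *:
    (logc j%:Z i%:Z *: y i%:Z))); last by move=> j _; rewrite E // scaler_sumr.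
by rewrite exchange_big /=; apply: eq_bigr => i _; rewrite D.
Qed.

End LogSubstitution.

Section LogProducts.
Variable W : lmodType C.
Implicit Types (a c d : int -> W -> W) (w : W) (i j k n m p q r t N : int) (e : bool).

(* The coefficient of [x2 ^ t] of the residue at [z = 0] of [z ^ n c(x2 exp z) d(x2)]. *)
Definition zprod n c d t w : W := zact n (fun i => rprod 0 i c d t w).

Definition local c d := exists N, loc N c d.

Lemma loc_vanish N p c d t w : is_field c -> is_field d -> loc N c d ->
  vanish_from N (fun i => rprod p i c d t w).
Proof. by move=> cf df h i hi; apply: (loc_le cf df h hi). Qed.

Lemma loc_fun0 N p i c d : is_field c -> is_field d -> loc N c d -> N <= i ->
  rprod p i c d = fun _ _ => 0.
Proof.
move=> cf df h hi; apply/funext => t; apply/funext => w.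
exact: (loc_vanish _ _ _ cf df h).
Qed.

Lemma zprod_fin N n c d (k : nat) : is_field c -> is_field d -> loc N c d -> N <= n + k%:Z ->
  zprod n c d = fun t w => \sum_(i < k) logc n (n + i%:Z) *: rprod 0 (n + i%:Z) c d t w.
Proof.
move=> cf df h hk; apply/funext => t; apply/funext => w.
exact: zact_fin (loc_vanish 0 t w cf df h) hk.
Qed.

Lemma zero_field : is_field (fun _ _ => 0 : W).
Proof.
split=> [n b x y|w]; first by rewrite scaler0 addr0.
by exists 0.
Qed.

Lemma sum_field (k : nat) (b : nat -> C) (D : nat -> int -> W -> W) :
  (forall j : nat, is_field (D j)) -> is_field (fun t w => \sum_(j < k) b j *: D j t w).
Proof.
move=> Df; elim: k => [|k IH].
  rewrite (_ : (fun _ _ => _) = fun _ _ => 0); first exact: zero_field.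
  by apply/funext => t; apply/funext => w; rewrite big_ord0.
have := field_comb (b k) (Df k) IH; rewrite (_ : (fun _ _ => _) =
  fun t w => \sum_(j < k.+1) b j *: D j t w) //.
by apply/funext => t; apply/funext => w; rewrite big_ord_recr addrC.
Qed.

Lemma zprod_field n c d : is_field c -> is_field d -> local c d -> is_field (zprod n c d).
Proof.
move=> cf df [N h]; rewrite (@zprod_fin N n c d (absz (N - n))) //; last by lia.
by apply: (@sum_field _ (fun i : nat => logc n (n + i%:Z))
  (fun i : nat => rprod 0 (n + i%:Z) c d)) => j; exact: rprod_field.
Qed.

Lemma rprod_r0 p i c t w : is_field c -> rprod p i c (fun _ _ => 0) t w = 0.
Proof.
move=> cf; have := rprod_linr p i 1 t w cf zero_field zero_field.
by rewrite scaler0 addr0 scale1r => /eqP; rewrite -subr_eq0 opprD addNKr oppr_eq0 => /eqP.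
Qed.

Lemma rprod_sumr p i c (k : nat) (b : nat -> C) (D : nat -> int -> W -> W) t w :
  is_field c -> (forall j : nat, is_field (D j)) ->
  rprod p i c (fun t w => \sum_(j < k) b j *: D j t w) t w
  = \sum_(j < k) b j *: rprod p i c (D j) t w.
Proof.
move=> cf Df; elim: k => [|k IH].
  rewrite (_ : (fun _ _ => _) = fun _ _ => 0) ?big_ord0; first exact: rprod_r0.
  by apply/funext => t'; apply/funext => w'; rewrite big_ord0.
rewrite big_ord_recr /= -IH addrC -rprod_linr //; last exact: sum_field.
rewrite (_ : (fun _ _ => \sum_(j < k.+1) _) =
  fun t w => b k *: D k t w + \sum_(j < k) b j *: D j t w) //.
by apply/funext => t'; apply/funext => w'; rewrite big_ord_recr addrC.
Qed.

Lemma rprod_zprod N n p i a c d t w : is_field a -> is_field c -> is_field d -> loc N c d ->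
  rprod p i a (zprod n c d) t w = zact n (fun k => rprod p i a (rprod 0 k c d) t w).
Proof.
move=> af cf df h; have hk : N <= n + (absz (N - n))%:Z by lia.
rewrite (zprod_fin cf df h hk) (@rprod_sumr _ _ _ _ (fun i : nat => logc n (n + i%:Z))
  (fun i : nat => rprod 0 (n + i%:Z) c d)) //; last by move=> j; exact: rprod_field.
rewrite (@zact_fin _ n _ N (absz (N - n))) // => k hk'.
by rewrite (loc_fun0 0 cf df h hk') rprod_r0.
Qed.

Section Commutator.
Variables (a c d : int -> W -> W) (J : nat) (cl : nat -> int -> W -> W).
Hypotheses (af : is_field a) (cf : is_field c) (df : is_field d)
  (clf : forall l, is_field (cl l)).
Hypothesis comm : forall q r w, a (- q) (c (- r) w) - c (- r) (a (- q) w)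
  = \sum_(l < J) ((l`!%:R)^-1 * q%:~R ^+ l) *: cl l (- (q + r)) w.
Variables (A K L : int).
Hypotheses (lA : loc A a d) (lK : loc K c d) (lL : forall l, (l < J)%N -> loc L (cl l) d).

Let rest p k t w j := \sum_(l < J) (l`!%:R)^-1 *:
  iter l (@Dop W) (fun k' => rprod p (k + k') (cl l) d t w) j.

Let restE p k t w j : rprod 0 j a (rprod p k c d) t w - rprod p k c (rprod 0 j a d) t w = rest
  p k t w j.
Proof. exact: rprod_comm. Qed.

Let vrest p k t w (l : nat) : (l < J)%N ->
  vanish_from (L - k) (fun k' => rprod p (k + k') (cl l) d t w).
Proof. by move=> lJ k' hk'; apply: (loc_vanish p t w (clf l) df (lL lJ)); lia. Qed.

Let rest0 p k t w j : L + J%:Z <= k + j -> rest p k t w j = 0.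
Proof.
move=> h; rewrite /rest big1 // => l _.
rewrite (@vanish_iter_Dop _ _ _ l (@vrest p k t w _ (ltn_ord l))) ?scaler0 //.
by have := ltn_ord l; lia.
Qed.

Lemma zprod_local n : local c (zprod n a d).
Proof.
exists (`|K| + `|L| + J%:Z + `|n|) => p t w.
rewrite (rprod_zprod _ _ _ _ _ cf af df lA) -[RHS](zsum0 W); apply: eq_zsum => i.
case: (ltrP i n) => hi; first by rewrite logc_lt ?scale0r.
have h := restE p (`|K| + `|L| + J%:Z + `|n|) t w i.
move: h; rewrite rest0; last by lia.
rewrite (loc_fun0 p cf df lK); last by lia.
by rewrite rprod_r0 // sub0r => /eqP; rewrite oppr_eq0 => /eqP ->; rewrite scaler0.
Qed.

Lemma zprod_comm n q t w :
  zprod n a (zprod q c d) t w - zprod q c (zprod n a d) t w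
  = \sum_(l < J) zbinom n l *: zprod (n + q - l%:Z) (cl l) d t w.
Proof.
pose X i k := rprod 0 i a (rprod 0 k c d) t w.
pose Y i k := rprod 0 k c (rprod 0 i a d) t w.
have XY i k : X i k - Y i k = rest 0 k t w i := restE 0 k t w i.
have X0 i k : K <= k -> X i k = 0.
  by move=> h; rewrite /X (loc_fun0 0 cf df lK h) rprod_r0.
have Y0 i k : A <= i -> Y i k = 0.
  by move=> h; rewrite /Y (loc_fun0 0 af df lA h) rprod_r0.
have eXY i k : L + J%:Z <= k + i -> X i k = Y i k.
  by move=> h; apply/eqP; rewrite -subr_eq0 XY rest0.
pose B := `|A| + `|K| + `|L| + J%:Z + `|n| + `|q|.
have bd (Z : int -> int -> W) : (forall i k, n <= i -> q <= k -> (B < i) || (B < k) -> Z i k = 0) ->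
    bounded2 (fun k i => logc q k *: (logc n i *: Z i k)).
  move=> hZ; exists B => k i hki.
  case: (ltrP k q) => hk; first by rewrite logc_lt ?scale0r.
  case: (ltrP i n) => hi; first by rewrite [logc n i]logc_lt // scale0r scaler0.
  by rewrite hZ ?scaler0 //; lia.
have bX : bounded2 (fun k i => logc q k *: (logc n i *: X i k)).
  apply: bd => i k hi hk hb; case: (lerP K k) => hK; first exact: X0.
  by rewrite eXY; [apply: Y0; lia|lia].
have bY : bounded2 (fun k i => logc q k *: (logc n i *: Y i k)).
  apply: bd => i k hi hk hb; case: (lerP A i) => hA; first exact: Y0.
  by rewrite -eXY; [apply: X0; lia|lia].
have EX : zprod n a (zprod q c d) t w = zsum (fun k => zsum (fun i =>
  logc q k *: (logc n i *: X i k))).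
  have bX' : bounded2 (fun i k => logc n i *: (logc q k *: X i k)).
    have [M hM] := bX; exists M => i k hik.
    by rewrite scalerA mulrC -scalerA; apply: hM; lia.
  transitivity (zsum (fun i => zsum (fun k => logc n i *: (logc q k *: X i k)))).
    apply: eq_zsum => i; rewrite (rprod_zprod _ _ _ _ _ af cf df lK) /zact -zsumZ //.
    by apply: (@zact_bounded _ q _ K) => k hk; rewrite -/(X i k) X0.
  rewrite zsum_exchange //; apply: eq_zsum => k; apply: eq_zsum => i.
  by rewrite scalerA mulrC -scalerA.
have EY : zprod q c (zprod n a d) t w = zsum (fun k => zsum (fun i =>
  logc q k *: (logc n i *: Y i k))).
  apply: eq_zsum => k; rewrite (rprod_zprod _ _ _ _ _ cf af df lA) /zact -zsumZ //.
  by apply: (@zact_bounded _ n _ A) => i hi; rewrite -/(Y i k) Y0.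
pose P l k := rprod 0 k (cl l) d t w.
have vP (l : nat) : (l < J)%N -> vanish_from L (P l).
  by move=> lJ; apply: loc_vanish (lL lJ).
have vPz (l : nat) : (l < J)%N ->
    vanish_from (L - (n - l%:Z)) (fun k => zact (n - l%:Z) (fun k' => P l (k + k'))).
  move=> lJ k hk; apply: (@zact_vanish _ _ _ (L - k)); last by lia.
  by move=> k' hk'; apply: (vP l lJ); lia.
rewrite EX EY -zsumB; try exact: bounded2_zsum.
transitivity (zact q (fun k => \sum_(l < J) zbinom n l *:
    zact (n - l%:Z) (fun k' => P l (k + k')))).
  apply: eq_zsum => k; rewrite -zsumB; [|exact: (bounded2_row k bX)|exact: (bounded2_row k bY)].
  transitivity (logc q k *: zact n (rest 0 k t w)).
    rewrite /zact -zsumZ; first by apply: eq_zsum => i; rewrite -!scalerBr XY.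
    by apply: (@zact_bounded _ n _ (L + J%:Z - k)) => i hi; apply: rest0; lia.
  congr (_ *: _); rewrite (@zact_sum _ J n (fun l j =>
    (l`!%:R)^-1 *: iter l (@Dop W) (fun k' => P l (k + k')) j)).
    apply: eq_bigr => l _; have v := @vrest 0 k t w _ (ltn_ord l).
    by rewrite (zactZ _ _ (@vanish_iter_Dop _ _ _ l v)) (zact_iter_Dop _ _ v).
  move=> l lJ; exists (L - k + l%:Z) => i hi.
  by rewrite (@vanish_iter_Dop _ _ _ l (@vrest 0 k t w _ lJ)) ?scaler0.
rewrite (@zact_sum _ J q (fun l k => zbinom n l *: zact (n - l%:Z) (fun k' =>
  P l (k + k')))); last first.
  by move=> l lJ; exists (L - (n - l%:Z)) => k hk; rewrite vPz // scaler0.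
apply: eq_bigr => l _; rewrite (zactZ _ _ (vPz l (ltn_ord l))); congr (_ *: _).
by rewrite (zact_zact _ _ (vP l (ltn_ord l))) addrCA addrA.
Qed.

End Commutator.
End LogProducts.

Section DerivationAndVacuum.
Variable W : lmodType C.
Implicit Types (a c d : int -> W -> W) (w : W) (i j k n m p q r t N : int) (e : bool).

Lemma half_res_p0 e p c d t w : half_res e p 0 c d t w = ordered e c d (- p) (t + p) w.
Proof.
rewrite /half_res (@zsum1 _ p) ?subrr ?beta0 ?scale1r // => n /negbTE np.
by rewrite beta0 subr_eq0 np scale0r.
Qed.

Lemma rprod_p0 p c d t w :
  rprod p 0 c d t w = c (- p) (d (t + p) w) - d (t + p) (c (- p) w).
Proof. by rewrite /rprod !half_res_p0. Qed.

Lemma newton (U : lmodType C) (h : int -> int -> U) N (k : nat) p :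
  (forall p i, h (p + 1) i - h p i = h p (i + 1)) -> (forall p, h p N = 0) ->
  h p (N - k%:Z) = \sum_(i < k) zbinom p i *: h 0 (N - k%:Z + i%:Z).
Proof.
move=> hr h0; elim: k p => [|k IH] p; first by rewrite big_ord0 subr0.
pose g p := \sum_(i < k.+1) zbinom p i *: h 0 (N - k.+1%:Z + i%:Z).
have gS p' : g (p' + 1) - g p' = h p' (N - k%:Z).
  rewrite /g -sumrB big_ord_recl /= !zbinom0 subrr add0r IH.
  apply: eq_bigr => i _; rewrite -scalerBl /bump /= add1n zbinom_pascal addrAC subrr add0r.
  by congr (_ *: h _ _); lia.
have fS p' : h (p' + 1) (N - k.+1%:Z) - h p' (N - k.+1%:Z) = h p' (N - k%:Z).
  by rewrite hr; congr h; lia.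
have fc p' : h (p' + 1) (N - k.+1%:Z) - g (p' + 1) = h p' (N - k.+1%:Z) - g p'.
  have /eqP := fS p'; rewrite -(gS p') subr_eq => /eqP ->.
  by rewrite addrAC [X in X + _ = _]addrAC subrr sub0r addrC.
apply/eqP; rewrite -subr_eq0 -/(g p) (int_const fc p 0) /g big_ord_recl big1.
  by rewrite zbinom0 scale1r !addr0 subrr.
by move=> i _; rewrite zbinom_0S scale0r.
Qed.

Lemma local_comm (N : nat) a c q r w : is_field a -> is_field c -> loc N%:Z a c ->
  a (- q) (c (- r) w) - c (- r) (a (- q) w)
  = \sum_(l < N) ((l`!%:R)^-1 * q%:~R ^+ l) *: zprod l%:Z a c (- (q + r)) w.
Proof.
move=> af cf h.
rewrite (zact_exp q (loc_vanish 0 _ _ af cf h)).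
have := @newton W (fun p i => rprod p i a c (- (q + r)) w) N%:Z N q.
rewrite subrr => <-.
- by rewrite rprod_p0 (_ : - (q + r) + q = - r) //; ring.
- by move=> p i; apply: rprod_rec.
- by move=> p; apply: h.
Qed.

Definition xder c n w : W := n%:~R *: c n w.

Lemma xder_field c : is_field c -> is_field (xder c).
Proof.
move=> [cl cb]; split=> [n b x y|w].
  by rewrite /xder cl scalerDr !scalerA mulrC.
by have [N hN] := cb w; exists N => n hn; rewrite /xder hN ?scaler0.
Qed.

Lemma half_res_moment e p i c d t w : is_field c -> is_field d ->
  zsum (fun n => n%:~R *: (beta e i (n - p) *: ordered e c d (- n) (t + n) w))
  = p%:~R *: half_res e p i c d t w + Dop (fun i => half_res e p i c d t w) i.
Proof.
move=> cf df; have hb i' := half_res_bounded e p i' t w cf df.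
rewrite /Dop /half_res -zsumZ // -[zsum _ + zsum _]zsumD // -zsumZ; last exact: boundedD.
rewrite -zsumD; [|exact: bounded_scale|exact: (bounded_scale (fun _ =>
  i%:~R) (boundedD (hb i) (hb (i - 1))))].
apply: eq_zsum => n; rewrite -scalerDl !scalerA -scalerDl; congr (_ *: _).
rewrite -beta_D intrB; ring.
Qed.

Lemma rprod_xderl p i c d t w : is_field c -> is_field d ->
  rprod p i (xder c) d t w
  = - (p%:~R *: rprod p i c d t w + Dop (fun i => rprod p i c d t w) i).
Proof.
move=> cf df.
have E e : half_res e p i (xder c) d t w =
    - (p%:~R *: half_res e p i c d t w + Dop (fun i => half_res e p i c d t w) i).
  rewrite -half_res_moment // -scaleN1r -zsumZ.
    apply: eq_zsum => n; rewrite !scalerA [_ * beta _ _ _]mulrC -scalerA; congr (_ *: _).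
    rewrite /ordered /xder mulN1r -intrN; case: e => //.
    by rewrite islinZ //; exact: field_lin.
  by have [M h] := half_res_bounded e p i t w cf df; exists M => n /h ->; rewrite scaler0.
rewrite /rprod !E -opprD /Dop; congr (- _).
by rewrite opprD addrACA -!scalerBr opprD addrACA.
Qed.

Lemma rprod_xderr p i c d t w : is_field c -> is_field d ->
  rprod p i c (xder d) t w = t%:~R *: rprod p i c d t w
    + (p%:~R *: rprod p i c d t w + Dop (fun i => rprod p i c d t w) i).
Proof.
move=> cf df.
have E e : half_res e p i c (xder d) t w = t%:~R *: half_res e p i c d t w +
    (p%:~R *: half_res e p i c d t w + Dop (fun i => half_res e p i c d t w) i).
  have hb := half_res_bounded e p i t w cf df.
  rewrite -half_res_moment // /half_res -zsumZ // -zsumD;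
    [|exact: bounded_scale|exact: (bounded_scale intr hb)].
  apply: eq_zsum => n; rewrite -scalerDl -intrD scalerA mulrC -scalerA; congr (_ *: _).
  rewrite /ordered /xder; case: e {hb} => //.
  by rewrite islinZ //; exact: field_lin.
rewrite /rprod !E /Dop opprD addrACA -scalerBr; congr (_ + _).
by rewrite opprD addrACA -!scalerBr opprD addrACA.
Qed.

Lemma local_xderl c d : is_field c -> is_field d -> local c d -> local (xder c) d.
Proof.
move=> cf df [N h]; exists (N + 1) => p t w; rewrite rprod_xderl // /Dop.
by rewrite addrK !(loc_le cf df h) ?addr0 ?scaler0 ?addr0 ?oppr0 //; lia.
Qed.

Lemma zprod_xderl n c d t w : is_field c -> is_field d -> local c d ->
  zprod n (xder c) d t w = - (n%:~R *: zprod (n - 1) c d t w).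
Proof.
move=> cf df [N h]; have v := loc_vanish 0 t w cf df h.
rewrite /zprod -(zact_Dop _ v) -scaleN1r -(zactZ _ _ (vanish_Dop v)).
by apply: eq_zact => i; rewrite rprod_xderl // scale0r add0r scaleN1r.
Qed.

Lemma zprod_xderr n c d t w : is_field c -> is_field d -> local c d ->
  zprod n c (xder d) t w = t%:~R *: zprod n c d t w + n%:~R *: zprod (n - 1) c d t w.
Proof.
move=> cf df [N h]; have v := loc_vanish 0 t w cf df h.
have v' : vanish_from (N + 1) (fun i => rprod 0 i c d t w) by move=> i hi; apply: v; lia.
rewrite /zprod -(zact_Dop _ v) -(zact_lin _ _ v' (vanish_Dop v)).
by apply: eq_zact => i; rewrite rprod_xderr // scale0r add0r.
Qed.

Definition one_field n w : W := if n == 0 then w else 0.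

Lemma one_field_field : is_field one_field.
Proof.
split=> [n b x y|w]; rewrite /one_field.
  by case: eqP => // _; rewrite scaler0 addr0.
by exists 0 => n hn; rewrite ifF //; lia.
Qed.

Lemma local_onel c : is_field c -> loc 0 one_field c.
Proof.
move=> cf p t w; rewrite rprod_p0 /one_field; case: eqP => [e|_]; first by rewrite subrr.
by rewrite (islin0 (field_lin _ cf)) subrr.
Qed.

Lemma local_oner c : is_field c -> loc 0 c one_field.
Proof.
move=> cf p t w; rewrite rprod_p0 /one_field; case: eqP => [e|_]; first by rewrite subrr.
by rewrite (islin0 (field_lin _ cf)) subrr.
Qed.

(* [xi ^ n] has coefficient [betaD i n] in the formal distribution
   [iota_oo - iota_0] applied to [(xi - 1) ^ i]. *)
Definition betaD i n : C := beta true i n - beta false i n.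

Lemma betaD_nonneg i n : 0 <= i -> betaD i n = 0.
Proof. by case: i => // i _; rewrite /betaD beta_nonneg subrr. Qed.

Lemma betaD_Dop n i : Dop (fun i => betaD i n : C^o) i = n%:~R * betaD i n.
Proof.
rewrite /Dop -[_ *: _]/(_ * _) /betaD mulrBr !beta_D; ring.
Qed.

Lemma betaD_N1 n : betaD (-1) n = 1.
Proof.
have r m : betaD (-1) (m + 1) = betaD (-1) m.
  apply/esym/eqP; rewrite -subr_eq0; have := @beta_rec true (-1) (m + 1).
  have := @beta_rec false (-1) (m + 1); rewrite addrK (_ : -1 + 1 = 0) // !beta0 => e1 e2.
  rewrite /betaD; apply/eqP; rewrite e1 in e2.
  transitivity ((beta true (-1) m - beta true (-1) (m + 1)) - (beta false (-1) m - beta false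
    (-1) (m + 1))).
    by ring.
  by rewrite -e2 subrr.
by rewrite (int_const r n (-1)) /betaD beta_top (beta_side (e := false)) // subr0.
Qed.

Lemma zact_betaD n (r : int) :
  zact n (fun i => betaD i r : C^o) =
  if 0 <= n then 0 else ((absz n).-1`!%:R)^-1 * (- r%:~R) ^+ (absz n).-1.
Proof.
have v : vanish_from 0 (fun i => betaD i r : C^o) by move=> i; exact: betaD_nonneg.
case: n => n /=; first exact: (zact_vanish v).
elim: n => [|n IH].
  rewrite (@zact_fin _ _ _ 0 1) // big_ord1 /= addr0 NegzE logc_diag betaD_N1.
  by rewrite fact0 invr1 expr0 mulr1 scale1r.
have := zact_Dop (Negz n) v; rewrite (_ : Negz n - 1 = Negz n.+1); last lia.
rewrite (eq_zact _ (z := fun i => (r%:~R : C) *: (betaD i r : C^o))); last exact: betaD_Dop.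
rewrite (zactZ _ _ v) IH NegzE mulrNz -[_ *: _ in RHS]/(_ * _) => h.
have n0 := natCS_neq0 n; apply: (mulfI n0).
rewrite -[LHS]opprK -mulNr -h -[_ *: _]/(_ * _) factS natrM invfM exprS.
have f0 : n`!%:R != 0 :> C by rewrite pnatr_eq0 -lt0n fact_gt0.
by move: n0 f0 => {h}; move: (n.+1%:R) (n`!%:R) => x y x0 y0; field; rewrite x0 y0.
Qed.

Lemma zprod_onel n c t w : is_field c -> zprod n one_field c t w = if n == -1 then c t w else 0.
Proof.
move=> cf; rewrite /zprod.
have E i : rprod 0 i one_field c t w = (betaD i 0 : C) *: c t w.
  rewrite /rprod /half_res /betaD scalerBl; congr (_ - _).
    rewrite (@zsum1 _ 0) => [|n' /negbTE n0]; first by rewrite /ordered /one_field oppr0 eqxx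
      subr0 addr0.
    by rewrite /ordered /one_field oppr_eq0 n0 scaler0.
  rewrite (@zsum1 _ 0) => [|n' /negbTE n0]; first by rewrite /ordered /one_field oppr0 eqxx
    subr0 addr0.
  by rewrite /ordered /one_field oppr_eq0 n0 islin0 ?scaler0 //; exact: field_lin.
rewrite (eq_zact _ E).
have v : vanish_from 0 (fun i => betaD i 0 : C^o) by move=> i; exact: betaD_nonneg.
transitivity ((zact n (fun i => betaD i 0 : C^o) : C) *: c t w).
  rewrite /zact -zsum_scalel; last exact: zact_bounded v.
  by apply: eq_zsum => i; rewrite scalerA.
rewrite zact_betaD; case: n => [n|[|n]] /=; first by rewrite scale0r.
  by rewrite fact0 invr1 expr0 mulr1 scale1r.
by rewrite oppr0 expr0n mulr0 scale0r.
Qed.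

Lemma zprod_oner n c t w : is_field c -> zprod n c one_field t w =
  if 0 <= n then 0 else (((absz n).-1`!%:R)^-1 * t%:~R ^+ (absz n).-1) *: c t w.
Proof.
move=> cf; rewrite /zprod.
have E i : rprod 0 i c one_field t w = (betaD i (- t) : C) *: c t w.
  rewrite /rprod /half_res /betaD scalerBl; congr (_ - _).
    rewrite (@zsum1 _ (- t)) => [|n' n0]; first by rewrite /ordered /one_field subrr eqxx subr0
      opprK.
    rewrite /ordered /one_field ifF; last by lia.
    by rewrite islin0 ?scaler0 //; exact: field_lin.
  rewrite (@zsum1 _ (- t)) => [|n' n0]; first by rewrite /ordered /one_field subrr eqxx subr0 opprK.
  by rewrite /ordered /one_field ifF ?scaler0 //; lia.
rewrite (eq_zact _ E).
have v : vanish_from 0 (fun i => betaD i (- t) : C^o) by move=> i; exact: betaD_nonneg.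
transitivity ((zact n (fun i => betaD i (- t) : C^o) : C) *: c t w).
  rewrite /zact -zsum_scalel; last exact: zact_bounded v.
  by apply: eq_zsum => i; rewrite scalerA.
rewrite zact_betaD; case: (0 <= n); first by rewrite scale0r.
by rewrite mulrNz opprK.
Qed.

Lemma half_res_conv e i k c d t w : is_field c -> is_field d ->
  half_res e 0 (i + k) c d t w = zsum (fun m => beta e i m *: half_res e m k c d t w).
Proof.
move=> cf df; have [R hR] := ordered_vanish e t w cf df.
pose F n m := (beta e i m * beta e k (n - m)) *: ordered e c d (- n) (t + n) w.
have Fb : bounded2 F.
  exists (`|i| + `|k| + `|R|) => n m hnm; rewrite /F.
  case: (boolP (if e then n < R else R < n)) => hr; first by rewrite hR ?scaler0.
  case: (boolP (if e then i < m else m < 0)) => hm; first by rewrite beta_side ?mul0r ?scale0r.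
  by rewrite [beta e k _]beta_side ?mulr0 ?scale0r //; case: (e) hr hm; lia.
transitivity (zsum (fun n => zsum (F n))).
  apply: eq_zsum => n; rewrite subr0 -beta_conv -zsum_scalel //.
  exact: beta_bounded.
rewrite zsum_exchange //; apply: eq_zsum => m.
rewrite /half_res -zsumZ; last exact: half_res_bounded.
by apply: eq_zsum => n; rewrite scalerA.
Qed.

(* With [k] a locality exponent, [(x1 - x2) ^ k c(x1) d(x2)] is a Laurent
   series [F] in both variables, and [z ^ n (exp z - 1) ^ k] pairs with it
   as [Res z ^ n F(x2 exp z, x2)]. *)
Lemma zact_moment (k : nat) n c d t w : is_field c -> is_field d -> loc k%:Z c d ->
  zact n (fun i => rprod 0 (i + k%:Z) c d t w) =
  if 0 <= n then 0
  else zsum (fun a : int => (((absz n).-1`!%:R)^-1 * a%:~R ^+ (absz n).-1) *: half_res true (-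
    a) k%:Z c d t w).
Proof.
move=> cf df h.
pose H (m : int) := half_res true m k%:Z c d t w.
have HF m : half_res false m k%:Z c d t w = H m.
  by apply/esym/eqP; rewrite -subr_eq0; apply/eqP; exact: h.
have [N Hlo] : exists N, forall m : int, m < N -> H m = 0.
  have [R hR] := ordered_vanish true t w cf df.
  exists (R - k%:Z) => m hm; rewrite -[RHS](zsum0 W); apply: eq_zsum => n'.
  case: (ltrP n' R) => hn; first by rewrite hR ?scaler0.
  by rewrite beta_side ?scale0r //; lia.
have [M Hhi] : exists M, forall m, M < m -> H m = 0.
  have [R hR] := ordered_vanish false t w cf df.
  exists R => m hm; rewrite -HF -[RHS](zsum0 W); apply: eq_zsum => n'.
  case: (ltrP R n') => hn; first by rewrite hR ?scaler0.
  by rewrite beta_side ?scale0r //; lia.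
have Hb (x : int -> C) : bounded (fun m => x m *: H m).
  apply: (@bounded_range _ N M) => m /orP[hm|hm]; first by rewrite Hlo ?scaler0.
  by rewrite Hhi ?scaler0.
have E i : rprod 0 (i + k%:Z) c d t w = zsum (fun m => betaD i m *: H m).
  rewrite /rprod !half_res_conv // -zsumB; [| exact: Hb |].
    by apply: eq_zsum => m; rewrite HF -scalerBl.
  by have [B hB] := Hb (beta false i); exists B => m /hB; rewrite HF.
rewrite (eq_zact _ E) /zact.
have v m : vanish_from 0 (fun i => betaD i m : C^o) by move=> i; exact: betaD_nonneg.
pose G i m := (logc n i * betaD i m) *: H m.
have Gb : bounded2 G.
  exists (`|n| + `|N| + `|M|) => i m him; rewrite /G.
  case: (ltrP i n) => hi; first by rewrite logc_lt ?mul0r ?scale0r.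
  case: (lerP 0 i) => hi0; first by rewrite betaD_nonneg ?mulr0 ?scale0r.
  case: (ltrP m N) => hm; first by rewrite Hlo ?scaler0.
  by rewrite Hhi ?scaler0 //; lia.
transitivity (zsum (fun i => zsum (G i))).
  apply: eq_zsum => i; rewrite -zsumZ //.
  by apply: eq_zsum => m; rewrite scalerA.
rewrite zsum_exchange //.
transitivity (zsum (fun m => (zact n (fun i => betaD i m : C^o) : C) *: H m)).
  apply: eq_zsum => m; rewrite -zsum_scalel; last exact: zact_bounded (v m).
  by apply: eq_zsum => i.
case: ifP => n0.
  rewrite -[RHS](zsum0 W); apply: eq_zsum => m.
  by rewrite zact_betaD n0 scale0r.
rewrite (@zsum_reindex _ -%R); last by exists -%R; exact: opprK.
by apply: eq_zsum => a; rewrite zact_betaD n0 mulrNz opprK.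
Qed.

End DerivationAndVacuum.

(** * Weak associativity in coordinates *)

Lemma binomial_inversion (k i : nat) :
  \sum_(p < k.+1) ('C(k, p)%:R * (-1) ^+ (k - p)) * 'C(p, i)%:R = (i == k)%:R :> C.
Proof.
have -> : (i == k)%:R = (('X : {poly C}) ^+ k)`_i by rewrite coefXn.
have e : ('X : {poly C}) ^+ k = (-1 + ('X + 1)) ^+ k by congr (_ ^+ k); ring.
rewrite e exprDn coef_sum; apply: eq_bigr => p _.
rewrite exprD1n coefMn (_ : (-1 : {poly C}) ^+ (k - p) = ((-1) ^+ (k - p))%:P); last first.
  by rewrite rmorphXn /= polyCN.
rewrite coefCM coef_sum -[RHS]mulr_natl mulrA; congr (_ * _).
case: (ltnP i p.+1) => h.
  rewrite (bigD1 (Ordinal h)) //= coefMn coefXn eqxx big1 ?addr0 // => j.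
  by rewrite -val_eqE /= => /negbTE ne; rewrite coefMn coefXn eq_sym ne mul0rn.
rewrite bin_small // big1 // => j _; rewrite coefMn coefXn.
by rewrite (_ : (i == j) = false) ?mul0rn //; have := ltn_ord j; lia.
Qed.

Section AssocSum.
Variable U : lmodType C.
Implicit Types (y h : int -> U) (M q n : int) (k : nat).

(* The coefficient of [z ^ q] in [(exp z - 1) ^ k \sum_(n < M) h n z ^ (- n - 1)]. *)
Definition assoc_sum k h M q : U :=
  \sum_(p < k.+1) ('C(k, p)%:R * (-1) ^+ (k - p)) *:
    \sum_(j < absz (q + M + 1) | (j%:Z < q + M + 1))
       ((j`!%:R)^-1 * (p%:R ^+ j)) *: h (j%:Z - q - 1).

Lemma assoc_sum_ext h M q (J : nat) (p : C) :
  (forall n, M <= n -> h n = 0) -> q + M + 1 <= J%:Z ->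
  \sum_(j < absz (q + M + 1) | (j%:Z < q + M + 1))
       ((j`!%:R)^-1 * (p ^+ j)) *: h (j%:Z - q - 1)
  = \sum_(j < J) ((j`!%:R)^-1 * (p ^+ j)) *: h (j%:Z - q - 1).
Proof.
move=> h0 hJ; case: (lerP (q + M + 1) 0) => hq.
  rewrite big_pred0 => [|j]; last by apply/negbTE; lia.
  by rewrite big1 // => j _; rewrite h0 ?scaler0 //; lia.
rewrite (eq_bigl xpredT); last by move=> j; have := ltn_ord j; lia.
have e : J = (absz (q + M + 1)%R + (J - absz (q + M + 1)%R))%N by lia.
rewrite e big_split_ord /= [X in _ = _ + X]big1 ?addr0 // => j _.
by rewrite h0 ?scaler0 //; lia.
Qed.

Lemma assoc_sum_zact k y K M q : vanish_from K y ->
  (forall n, M <= n -> zact n y = 0) ->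
  assoc_sum k (fun n => zact n y) M q = zact (- q - 1) (fun i => y (i + k%:Z)).
Proof.
move=> v v0; pose g (m : int) := zact (- q - 1) (fun i => y (m + i)).
pose J := (absz q + absz M + absz K + k).+2.
have vg : vanish_from J%:Z g.
  move=> m hm; apply: (@zact_vanish _ _ _ (K - m)); last by lia.
  by move=> i hi; apply: v; lia.
transitivity (\sum_(p < k.+1) ('C(k, p)%:R * (-1) ^+ (k - p)) *: \sum_(i < J) ('C(p, i)%:R : C)
  *: g i%:Z).
  apply: eq_bigr => p _; congr (_ *: _); rewrite (@assoc_sum_ext (fun n =>
    zact n y) M q J) //; last by lia.
  have e := zact_exp p%:Z vg; rewrite -pmulrn in e.
  transitivity (\sum_(i < J) zbinom p%:Z i *: g i%:Z); last by apply: eq_bigr => i _;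
    rewrite zbinom_nat.
  rewrite -e; apply: eq_bigr => j _; congr (_ *: _).
  rewrite /g (zact_zact _ _ v) (_ : j%:Z - q - 1 = j%:Z + (- q - 1)) //; ring.
transitivity (\sum_(i < J) ((i == k :> nat)%:R : C) *: g i%:Z).
  under eq_bigr do rewrite scaler_sumr.
  rewrite exchange_big /=; apply: eq_bigr => i _.
  by rewrite -binomial_inversion scaler_suml; apply: eq_bigr => p _; rewrite scalerA.
have kJ : (k < J)%N by rewrite /J; lia.
rewrite (bigD1 (Ordinal kJ)) //= eqxx scale1r big1 ?addr0.
  by apply: eq_zact => i; rewrite addrC.
by move=> i; rewrite -val_eqE /= => /negbTE ->; rewrite scale0r.
Qed.

Let expc k (j : nat) : C :=
  \sum_(p < k.+1) ('C(k, p)%:R * (-1) ^+ (k - p)) * ((j`!%:R)^-1 * p%:R ^+ j).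

Let expc_logc k (i : nat) : \sum_(j < i.+1) expc k j * logc j%:Z i%:Z = (i == k)%:R.
Proof.
rewrite -binomial_inversion.
transitivity (\sum_(p < k.+1) ('C(k, p)%:R * (-1) ^+ (k - p)) * zbinom p%:Z i).
  under eq_bigr => j _ do rewrite /expc mulr_suml.
  rewrite exchange_big /=; apply: eq_bigr => p _.
  by rewrite -zbinom_logc mulr_sumr; apply: eq_bigr => j _; rewrite !mulrA.
by apply: eq_bigr => p _; rewrite zbinom_nat.
Qed.

Let expc_le k (j : nat) : (j <= k)%N -> expc k j = (j == k)%:R.
Proof.
elim/ltn_ind: j => j IH jk; rewrite -expc_logc big_ord_recr /= logc_diag mulr1.
rewrite big1 ?add0r // => i _; have ij := ltn_ord i.
by rewrite IH ?(leq_trans (ltnW ij)) // (_ : (nat_of_ord i == k) = false) ?mul0r //; lia.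
Qed.

(* [(exp z - 1) ^ k] is not a zero divisor on Laurent series in [z]. *)
Lemma assoc_sum_inj k h M : (forall n, M <= n -> h n = 0) ->
  (forall q, assoc_sum k h M q = 0) -> forall n, h n = 0.
Proof.
move=> h0 hq.
suff H (m : nat) n : M - m%:Z <= n -> h n = 0 by move=> n; apply: (H (absz (M - n))); lia.
elim: m n => [|m IH] n hn; first by apply: h0; lia.
case: (lerP (M - m%:Z) n) => hn'; first exact: IH.
pose q := k%:Z - n - 1; pose J := (absz (q + M + 1)%R + k).+1.
rewrite -(hq q) /assoc_sum.
transitivity (\sum_(j < J) expc k j *: h (j%:Z - q - 1)).
  have kJ : (k < J)%N by rewrite /J; lia.
  rewrite (bigD1 (Ordinal kJ)) //= expc_le // eqxx scale1r big1 ?addr0.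
    by congr h; rewrite /q; lia.
  move=> j; rewrite -val_eqE /= => /negbTE ne.
  case: (leqP j k) => jk; first by rewrite expc_le // ne scale0r.
  by rewrite IH ?scaler0 // /q; lia.
transitivity (\sum_(p < k.+1) \sum_(j < J) ('C(k, p)%:R * (-1) ^+ (k - p)) *:
    (((j`!%:R)^-1 * p%:R ^+ j) *: h (j%:Z - q - 1))).
  rewrite exchange_big /=; apply: eq_bigr => j _.
  by rewrite /expc scaler_suml; apply: eq_bigr => p _; rewrite scalerA.
apply: eq_bigr => p _; rewrite -scaler_sumr; congr (_ *: _).
by rewrite (@assoc_sum_ext _ M q J) // /J; lia.
Qed.
End AssocSum.

Section Combinations.
Variable W : lmodType C.
Implicit Types (a c d : int -> W -> W) (w : W) (i j n m p q r t N : int) (e : bool).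

Lemma local_linr b c d d' : is_field c -> is_field d -> is_field d' ->
  local c d -> local c d' -> local c (fun n w => b *: d n w + d' n w).
Proof.
move=> cf df df' [N h] [M h']; exists (`|N| + `|M|) => p t w.
rewrite rprod_linr // (loc_le cf df h) 1?(loc_le cf df' h') ?scaler0 ?addr0 //; lia.
Qed.

Lemma local_linl b c c' d : is_field c -> is_field c' -> is_field d ->
  local c d -> local c' d -> local (fun n w => b *: c n w + c' n w) d.
Proof.
move=> cf cf' df [N h] [M h']; exists (`|N| + `|M|) => p t w.
rewrite rprod_linl // (loc_le cf df h) 1?(loc_le cf' df h') ?scaler0 ?addr0 //; lia.
Qed.

Lemma zprod_linr n b c d d' t w : is_field c -> is_field d -> is_field d' ->
  local c d -> local c d' ->
  zprod n c (fun n w => b *: d n w + d' n w) t w = b *: zprod n c d t w + zprod n c d' t w.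
Proof.
move=> cf df df' [N h] [M h'].
have v : vanish_from (`|N| + `|M|) (fun i => rprod 0 i c d t w).
  by move=> i hi; apply: (loc_vanish 0 t w cf df h); lia.
have v' : vanish_from (`|N| + `|M|) (fun i => rprod 0 i c d' t w).
  by move=> i hi; apply: (loc_vanish 0 t w cf df' h'); lia.
by rewrite /zprod -(zact_lin _ _ v v'); apply: eq_zact => i; rewrite rprod_linr.
Qed.

Lemma zprod_linl n b c c' d t w : is_field c -> is_field c' -> is_field d ->
  local c d -> local c' d ->
  zprod n (fun n w => b *: c n w + c' n w) d t w = b *: zprod n c d t w + zprod n c' d t w.
Proof.
move=> cf cf' df [N h] [M h'].
have v : vanish_from (`|N| + `|M|) (fun i => rprod 0 i c d t w).
  by move=> i hi; apply: (loc_vanish 0 t w cf df h); lia.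
have v' : vanish_from (`|N| + `|M|) (fun i => rprod 0 i c' d t w).
  by move=> i hi; apply: (loc_vanish 0 t w cf' df h'); lia.
by rewrite /zprod -(zact_lin _ _ v v'); apply: eq_zact => i; rewrite rprod_linl.
Qed.

Lemma zprod_r0 n c t w : is_field c -> zprod n c (fun _ _ => 0) t w = 0.
Proof.
move=> cf; rewrite -[RHS](zsum0 W); apply: eq_zsum => i.
by rewrite rprod_r0 // scaler0.
Qed.

Lemma zprod_l0 n d t w : is_field d -> zprod n (fun _ _ => 0) d t w = 0.
Proof.
move=> df; rewrite -[RHS](zsum0 W); apply: eq_zsum => i.
rewrite /rprod (_ : half_res true _ _ _ _ _ _ = 0) 1?(_ : half_res false _ _ _ _ _ _ = 0)
  ?subrr ?scaler0 //.
  by rewrite -[RHS](zsum0 W); apply: eq_zsum => m; rewrite /ordered (islin0 (field_lin _ df))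
    scaler0.
by rewrite -[RHS](zsum0 W); apply: eq_zsum => m; rewrite /ordered scaler0.
Qed.

Lemma local_r0 c : is_field c -> local c (fun _ _ => 0).
Proof. by move=> cf; exists 0 => p t w; apply: rprod_r0. Qed.

(* For generating fields [a], [b] of [W], this is the bracket of [\hat{L^*}], with [T^m (x) t^n]
   acting as the [z ^ n]-product with [T_m(x)]. *)
Lemma current_comm a b F d (P Q A B : C) :
  is_field a -> is_field b -> is_field F -> is_field d ->
  (forall q r w, a (- q) (b (- r) w) - b (- r) (a (- q) w)
     = (q%:~R * P - r%:~R * Q) *: F (- (q + r)) w
       + (kd (q + r) 0 * (A + q%:~R * B)) *: w) ->
  local a d -> local b d -> local F d ->
  (forall n, local b (zprod n a d)) /\
  (forall n s t w, zprod n a (zprod s b d) t w - zprod s b (zprod n a d) t w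
     = (n%:~R * P - s%:~R * Q) *: zprod (n + s - 1) F d t w
       + (kd (n + s + 1) 0 * A + n%:~R * kd (n + s) 0 * B) *: d t w).
Proof.
move=> af bf Ff df comm lad lbd lFd.
have of' := @one_field_field W; have zf := @zero_field W.
have lod : local (@one_field W) d by exists 0; exact: local_onel.
have lzd : local (fun _ _ => 0) d.
  by exists 0 => p t w; rewrite rprod_p0 (islin0 (field_lin _ df)) subrr.
pose E (x : C) n w : W := x *: one_field n w + 0.
have Ef x : is_field (E x) by exact: field_comb.
have lE x : local (E x) d by exact: local_linl.
have zE x n t w : zprod n (E x) d t w = (if n == -1 then x else 0) *: d t w.
  rewrite zprod_linl // zprod_onel //.
  by rewrite zprod_l0 // addr0; case: eqP; rewrite ?scaler0 ?scale0r.
have EE x n w : E x n w = x *: one_field n w by rewrite /E addr0.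
clearbody E.
pose cl l := if l == 0%N then fun n w => Q *: xder F n w + E A n w
  else fun n w => (P + Q) *: F n w + E B n w.
have xFf := xder_field Ff; have lxFd := local_xderl Ff df lFd.
have clf l : is_field (cl l) by rewrite /cl; case: eqP => _; exact: field_comb.
have lcl l : local (cl l) d by rewrite /cl; case: eqP => _; exact: local_linl.
have cm q r w : a (- q) (b (- r) w) - b (- r) (a (- q) w)
    = \sum_(l < 2) ((l`!%:R)^-1 * q%:~R ^+ l) *: cl l (- (q + r)) w.
  rewrite comm big_ord_recl big_ord1 /= /cl /= /bump /= !fact0 invr1 expr0 expr1 !mul1r scale1r.
  rewrite !EE /one_field oppr_eq0 /kd /xder scalerDr !scalerA addrACA -scalerDl.
  congr (_ *: _ + _); first by rewrite intrN intrD; ring.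
  by case: eqP => _; rewrite ?mul0r ?scale0r ?scaler0 ?addr0 // mul1r -scalerDl.
have [Na ha] := lad; have [Nb hb] := lbd.
have [L hL] : exists L, forall l, (l < 2)%N -> loc L (cl l) d.
  have [L0 h0] := lcl 0%N; have [L1 h1] := lcl 1%N; exists (`|L0| + `|L1|).
  case=> [|[|//]] _; first by apply: (loc_le (clf _) df h0); lia.
  by apply: (loc_le (clf _) df h1); lia.
split=> [n|n s t w]; first exact: (zprod_local af bf df clf cm ha hb hL).
rewrite (zprod_comm af bf df clf cm ha hb hL) big_ord_recl big_ord1 /= /bump /= !subr0.
rewrite zbinom0 scale1r zbinomS zbinom0 subr0 mul1r divr1 /cl /=.
rewrite (zprod_linl _ _ _ _ xFf (Ef A) df lxFd (lE A)) (zprod_linl _ _ _ _ Ff (Ef B) df lFd (lE B)).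
rewrite zprod_xderl // !zE.
rewrite scalerN scalerDr !scalerA -scaleNr addrACA -!scalerDl.
rewrite (_ : n + s - 1 == -1 = (n + s == 0)); last by apply/eqP/eqP; lia.
rewrite (_ : (n + s == -1) = (n + s + 1 == 0)); last by apply/eqP/eqP; lia.
rewrite /kd; congr (_ *: _ + _ *: _); first by rewrite intrD; ring.
by do 2!case: eqP => _; ring.
Qed.

Lemma half_res_fin e (k : nat) c d (x y : int) w :
  half_res e (- x) k%:Z c d (x + y - k%:Z) w =
  \sum_(p < k.+1) beta e k%:Z p%:Z *: ordered e c d (x - p%:Z) (y - k%:Z + p%:Z) w.
Proof.
rewrite /half_res (@zsum_range _ (- x) k.+1) => [|n hn].
  apply: eq_bigr => p _; congr (beta _ _ _ *: ordered _ _ _ _ _ _); ring.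
case: (ltrP (n + x) 0) => h.
  case: e; last by rewrite beta_side ?scale0r // opprK.
  by rewrite beta_nonneg beta_side ?scale0r // opprK.
case: e; first by rewrite beta_side ?scale0r // opprK; lia.
by rewrite -beta_nonneg beta_side ?scale0r // opprK; lia.
Qed.

Lemma loc_truncated (k : nat) c d w : is_field c -> is_field d -> loc k%:Z c d ->
  exists N, forall x y : int, (x < N) || (y < N) ->
    half_res true (- x) k%:Z c d (x + y - k%:Z) w = 0.
Proof.
move=> cf df h; have [N hN] := field_lb w cf; have [M hM] := field_lb w df.
exists (- (`|N| + `|M|)) => x y /orP[hx|hy].
  have := h (- x) (x + y - k%:Z) w; rewrite /rprod => /eqP; rewrite subr_eq0 => /eqP ->.
  rewrite half_res_fin big1 // => p _.
  by rewrite /ordered hN ?(islin0 (field_lin _ df)) ?scaler0 //; lia.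
rewrite half_res_fin big1 // => p _; have := ltn_ord p => hp.
by rewrite /ordered hM ?(islin0 (field_lin _ cf)) ?scaler0 //; lia.
Qed.

Lemma loc_of_truncated (k : nat) c d : is_field c -> is_field d -> local c d ->
  (forall w, exists N, forall x y : int, x < N ->
    half_res true (- x) k%:Z c d (x + y - k%:Z) w = 0) ->
  loc k%:Z c d.
Proof.
move=> cf df [K h] tr.
have {}tr (j : nat) w : exists R, forall p t, R < p -> half_res true p (k%:Z + j%:Z) c d t w = 0.
  elim: j => [|j [R hR]].
    have [N hN] := tr w; exists (- N) => p t hp.
    have := hN (- p) (t + p + k%:Z); rewrite opprK addr0 => <-; last by lia.
    by rewrite (_ : - p + (t + p + k%:Z) - k%:Z = t) ?opprK //; ring.
  exists `|R| => p t hp; rewrite -addn1 PoszD addrA -half_res_rec // !hR ?subrr //; lia.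
have {}h : loc (k%:Z + (absz K)%:Z) c d by apply: (loc_le cf df h); lia.
elim: (absz K) h => [|j IH] h; first by rewrite addr0 in h.
apply: IH => p t w; have [R hR] := tr j w; have [R' hR'] := ordered_vanish false t w cf df.
have cst p' : rprod (p' + 1) (k%:Z + j%:Z) c d t w = rprod p' (k%:Z + j%:Z) c d t w.
  apply/eqP; rewrite -subr_eq0 rprod_rec // (_ : _ + 1 = k%:Z + j.+1%:Z); last by lia.
  by apply/eqP; exact: h.
rewrite (int_const cst p (`|R| + `|R'| + 1)) /rprod hR ?sub0r; last by lia.
apply/eqP; rewrite oppr_eq0; apply/eqP; rewrite -[RHS](zsum0 W); apply: eq_zsum => n.
case: (ltrP R' n) => hn; first by rewrite hR' ?scaler0.
by rewrite beta_side ?scale0r //; lia.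
Qed.

End Combinations.

(** * Local fields as a module for the affine algebra *)

Record submodule (V : lmodType C) := Submodule {
  sm_mem :> V -> Prop;
  sm_0 : sm_mem 0;
  sm_lin : forall (b : C) x y, sm_mem x -> sm_mem y -> sm_mem (b *: x + y) }.

Definition sm_pred (V : lmodType C) (S : submodule V) : pred V := fun x => `[< S x >].

Lemma sm_closed (V : lmodType C) (S : submodule V) : submod_closed (sm_pred S).
Proof.
split; first by rewrite unfold_in; apply/asboolP; exact: sm_0.
by move=> b x y; rewrite !unfold_in => /asboolP hx /asboolP hy; apply/asboolP; exact: sm_lin.
Qed.

HB.instance Definition _ (V : lmodType C) (S : submodule V) :=
  GRing.isSubmodClosed.Build C V (sm_pred S) (sm_closed S).

Definition sm_type (V : lmodType C) (S : submodule V) := {x : V | sm_pred S x}.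
HB.instance Definition _ (V : lmodType C) (S : submodule V) := SubChoice.on (sm_type S).
HB.instance Definition _ (V : lmodType C) (S : submodule V) :=
  [SubChoice_isSubLmodule of sm_type S by <:].

Lemma smP (V : lmodType C) (S : submodule V) (x : sm_type S) : S (val x).
Proof. by apply/asboolP; exact: (valP x). Qed.

Definition sm_sub (V : lmodType C) (S : submodule V) x (h : S x) : sm_type S :=
  Sub x (asboolT h).

Lemma sm_subK (V : lmodType C) (S : submodule V) x (h : S x) : val (sm_sub h) = x.
Proof. exact: SubK. Qed.

Lemma sm_valL (V : lmodType C) (S : submodule V) : islin (val : sm_type S -> V).
Proof. by move=> b x y; rewrite linearP. Qed.

Section GeneratingFields.
Variables (l1 l2 l3 l4 : C) (W : lmodType C) (tW EW : int -> int -> W -> W).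
Hypotheses (HW : Lstar_module l1 l2 l3 l4 tW EW) (Hres : restricted tW EW).
Implicit Types (g h : bool * int) (w : W) (m n q r t : int).

(* [(false, m)] and [(true, m)] index the fields [T_m(x)] and [E_m(x)]. *)
Definition gen_mode g n w : W := if g.1 then tz EW g.2 n w else tz tW g.2 n w.

Definition gen_field g n w := gen_mode g (- n) w.

Lemma gen_mode_lin g n : islin (gen_mode g n).
Proof.
move=> b x y; rewrite /gen_mode /tz; have [tl [El _]] := HW.
case: g.1; case: nz; rewrite ?scaler0 ?addr0 //; [exact: El | exact: tl].
Qed.

Lemma gen_field_field g : is_field (gen_field g).
Proof.
split=> [n|w]; first exact: gen_mode_lin.
have [N hN] := Hres g.2 w; exists (- N) => n hn.
have [h1 h2] : tW g.2 (- n) w = 0 /\ EW g.2 (- n) w = 0 by apply: hN; lia.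
by rewrite /gen_field /gen_mode /tz h1 h2; case: g.1; case: nz.
Qed.

Definition gen_eps g h : C := (g.1 || h.1)%:R.
Definition gen_lvl (a b : C) g h : C := if g.1 && h.1 then b else if g.1 || h.1 then a else 0.

Lemma gen_comm g h q r w :
  gen_mode g q (gen_mode h r w) - gen_mode h r (gen_mode g q w) =
  ((q * h.2 - g.2 * r)%:~R * gen_eps g h) *: gen_mode (g.1 && h.1, g.2 + h.2) (q + r) w
  + (kd (g.2 + h.2) 0 * kd (q + r) 0
     * (g.2%:~R * gen_lvl l1 l3 g h + q%:~R * gen_lvl l2 l4 g h)) *: w.
Proof.
have [_ [_ [TT [TE EE]]]] := HW.
have z0 g' n w' : nz g'.2 n = false -> gen_mode g' n w' = 0.
  by rewrite /gen_mode /tz => ->; case: g'.1.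
case: (boolP (nz g.2 q)) => [gq|/negbTE gq]; last first.
  rewrite !(z0 g) // (islin0 (gen_mode_lin h r)) subrr.
  have [-> ->] : g.2 = 0 /\ q = 0 by move: gq; rewrite /nz; lia.
  by rewrite !mul0r scale0r add0r addr0 mulr0 scale0r.
case: (boolP (nz h.2 r)) => [hr|/negbTE hr]; last first.
  rewrite !(z0 h) // (islin0 (gen_mode_lin g q)) subrr.
  have [-> ->] : h.2 = 0 /\ r = 0 by move: hr; rewrite /nz; lia.
  rewrite !mulr0 subrr mul0r scale0r add0r !addr0 /kd.
  case: eqP => [->|_]; last by rewrite !mul0r scale0r.
  case: eqP => [->|_]; last by rewrite mulr0 mul0r scale0r.
  by rewrite !mul0r addr0 mulr0 scale0r.
case: g h gq hr => [[] m] [[] r'] /= gq hr; rewrite /gen_mode /gen_eps /gen_lvl /=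
  {1 2 3 4}/tz gq hr.
- by rewrite EE // mulr1.
- have /eqP := TE r' r m q w hr gq; rewrite -eqr_opp opprB => /eqP ->.
  rewrite opprD -(scaleNr _ (tz _ _ _ _)) -(scaleNr _ w) -rmorphN opprB mulr1 [r' + m]addrC [r
    + q]addrC.
  congr (_ *: _ + _ *: _); first by congr (_%:~R); ring.
  rewrite /kd; case: eqP => [e1|_]; last by rewrite !mul0r oppr0.
  case: eqP => [e2|_]; last by rewrite mulr0 !mul0r oppr0.
  rewrite (_ : r' = - m) 1?(_ : r = - q); try lia.
  by rewrite !intrN; ring.
- by rewrite TE // mulr1.
- by rewrite TT // mulr0 scale0r add0r !mulr0 addr0 mulr0 scale0r.
Qed.

Definition smooth (c : int -> W -> W) := is_field c /\ forall g, local (gen_field g) c.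

Lemma gen_zprod_comm g h n s d t w : smooth d ->
  zprod n (gen_field g) (zprod s (gen_field h) d) t w
  - zprod s (gen_field h) (zprod n (gen_field g) d) t w
  = ((n * h.2 - g.2 * s)%:~R * gen_eps g h) *:
      zprod (n + s - 1) (gen_field (g.1 && h.1, g.2 + h.2)) d t w
    + (kd (g.2 + h.2) 0 * (g.2%:~R * kd (n + s + 1) 0 * gen_lvl l1 l3 g h
       + n%:~R * kd (n + s) 0 * gen_lvl l2 l4 g h)) *: d t w.
Proof.
move=> [df dl].
have [|_ ->] := @current_comm W (gen_field g) (gen_field h) (gen_field (g.1 && h.1, g.2 + h.2)) d
  (h.2%:~R * gen_eps g h) (g.2%:~R * gen_eps g h)
  (kd (g.2 + h.2) 0 * (g.2%:~R * gen_lvl l1 l3 g h)) (kd (g.2 + h.2) 0 * gen_lvl l2 l4 g h)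
  (gen_field_field _) (gen_field_field _) (gen_field_field _) df _ (dl _) (dl _) (dl _).
  move=> q r w'; rewrite /gen_field !opprK gen_comm.
  by congr (_ *: _ + _ *: _); rewrite ?intrB ?intrM; ring.
by congr (_ *: _ + _ *: _); rewrite ?intrB ?intrM; ring.
Qed.

Lemma gen_zprod_smooth g n d : smooth d -> smooth (zprod n (gen_field g) d).
Proof.
move=> [df dl]; split=> [|h]; first by apply: zprod_field (gen_field_field g) df (dl g).
have [|+ _] := @current_comm W (gen_field g) (gen_field h) (gen_field (g.1 && h.1, g.2 + h.2)) d
  (h.2%:~R * gen_eps g h) (g.2%:~R * gen_eps g h)
  (kd (g.2 + h.2) 0 * (g.2%:~R * gen_lvl l1 l3 g h)) (kd (g.2 + h.2) 0 * gen_lvl l2 l4 g h)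
  (gen_field_field _) (gen_field_field _) (gen_field_field _) df _ (dl _) (dl _) (dl _); last exact.
move=> q r w'; rewrite /gen_field !opprK gen_comm.
by congr (_ *: _ + _ *: _); rewrite ?intrB ?intrM; ring.
Qed.

Lemma smooth0 : smooth 0.
Proof.
split; first exact: zero_field.
by move=> g; apply: local_r0; exact: gen_field_field.
Qed.

Lemma smooth_lin (b : C) c d : smooth c -> smooth d -> smooth (b *: c + d).
Proof.
move=> [cf cl] [df dl]; split; first exact: field_comb.
by move=> g; apply: local_linr => //; exact: gen_field_field.
Qed.

Lemma smooth_one : smooth (@one_field W).
Proof.
split=> [|g]; first exact: one_field_field.
by exists 0; apply: local_oner; exact: gen_field_field.
Qed.

Definition smooth_sm : submodule (int -> W -> W) := Submodule smooth0 smooth_lin.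

Definition smooth_op g n (x : sm_type smooth_sm) : sm_type smooth_sm :=
  @sm_sub _ smooth_sm _ (gen_zprod_smooth g n (smP x)).

Lemma smooth_opE g n x : val (smooth_op g n x) = zprod n (gen_field g) (val x).
Proof. exact: sm_subK. Qed.

Lemma smooth_op_lin g n : islin (smooth_op g n).
Proof.
move=> b x y; apply: val_inj.
rewrite [RHS]sm_valL !smooth_opE sm_valL.
have [xf xl] := smP x; have [yf yl] := smP y.
apply/funext => t; apply/funext => w.
by apply: zprod_linr => //; exact: gen_field_field.
Qed.

Lemma smooth_op_comm g h n s x :
  smooth_op g n (smooth_op h s x) - smooth_op h s (smooth_op g n x)
  = ((n * h.2 - g.2 * s)%:~R * gen_eps g h) *: smooth_op (g.1 && h.1, g.2 + h.2) (n + s - 1) x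
    + (kd (g.2 + h.2) 0 * (g.2%:~R * kd (n + s + 1) 0 * gen_lvl l1 l3 g h
       + n%:~R * kd (n + s) 0 * gen_lvl l2 l4 g h)) *: x.
Proof.
apply: val_inj; rewrite (islinB _ _ (sm_valL (S := smooth_sm))) [RHS]sm_valL.
rewrite (islinZ _ _ (sm_valL (S := smooth_sm))) !smooth_opE.
by apply/funext => t; apply/funext => w; exact: (gen_zprod_comm g h n s t w (smP x)).
Qed.

Lemma smooth_Lhat : Lhat_module l1 l2 l3 l4
  (fun m => smooth_op (false, m)) (fun m => smooth_op (true, m)).
Proof.
split; [by move=> m n; exact: smooth_op_lin|split; [by move=> m n; exact: smooth_op_lin|]].
split=> [m n r s x|]; last split=> m n r s x; rewrite smooth_op_comm /gen_eps /gen_lvl /=.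
- by rewrite mulr0 scale0r add0r !mulr0 addr0 mulr0 scale0r.
- by rewrite mulr1; congr (_ *: _ + _ *: _); ring.
- by rewrite mulr1; congr (_ *: _ + _ *: _); ring.
Qed.

Definition smooth_vac : sm_type smooth_sm := @sm_sub _ smooth_sm _ smooth_one.

Lemma smooth_vac_ann : nonneg_annihilated
  (fun m => smooth_op (false, m)) (fun m => smooth_op (true, m)) smooth_vac.
Proof.
have H g n : 0 <= n -> smooth_op g n smooth_vac = 0.
  move=> n0; apply: val_inj; rewrite smooth_opE sm_subK.
  apply/funext => t; apply/funext => w.
  by rewrite zprod_oner ?n0 //; exact: gen_field_field.
by move=> m n n0; rewrite !H.
Qed.

End GeneratingFields.

(** * State-field correspondence *)

Lemma prod_coefE (V W : lmodType C) (YW : V -> int -> W -> W) k u v w a b :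
  prod_coef YW k u v w a b = half_res true (- a) k%:Z (YW u) (YW v) (a + b - k%:Z) w.
Proof.
rewrite half_res_fin /prod_coef; apply: eq_bigr => p _.
by rewrite beta_nat // -ltnS.
Qed.

Lemma loc_uniform (W : lmodType C) (J : nat) (c : nat -> int -> W -> W) d :
  (forall l, is_field (c l)) -> is_field d -> (forall l, local (c l) d) ->
  exists L, forall l, (l < J)%N -> loc L (c l) d.
Proof.
move=> cf df h; elim: J => [|J [L hL]]; first by exists 0.
have [M hM] := h J; exists (`|L| + `|M|) => l.
rewrite ltnS leq_eqVlt => /orP[/eqP ->|lJ]; first by apply: (loc_le (cf _) df hM); lia.
by apply: (loc_le (cf _) df (hL l lJ)); lia.
Qed.

Section VacuumModule.
Variables (l1 l2 l3 l4 : C) (V : lmodType C) (TV EV : int -> int -> V -> V) (vac : V).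
Hypothesis HV : vacuum_module l1 l2 l3 l4 TV EV vac.

Definition vmode (g : bool * int) n v := if g.1 then EV g.2 n v else TV g.2 n v.

Lemma vmode_lin g n : islin (vmode g n).
Proof. by have [[Tl [El _]] _] := HV; rewrite /vmode; case: g.1; [exact: El | exact: Tl]. Qed.

Lemma vacuum_module_ind (P : V -> Prop) : P 0 ->
  (forall (b : C) x y, P x -> P y -> P (b *: x + y)) -> P vac ->
  (forall g n v, P v -> P (vmode g n v)) -> forall v, P v.
Proof.
move=> P0 PL Pvac PX; pose S := Submodule P0 PL.
pose op g n (x : sm_type S) : sm_type S := @sm_sub _ S _ (PX g n _ (smP x)).
have opE g n x : val (op g n x) = vmode g n (val x) := sm_subK _.
pose vl := @sm_valL _ S.
pose s1 : sm_type S := @sm_sub _ S _ Pvac.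
have [[Tl [El [TT [TE EE]]]] [ann univ]] := HV.
have HS : Lhat_module l1 l2 l3 l4 (fun m => op (false, m)) (fun m => op (true, m)).
  split=> [m n b x y|]; first by apply: val_inj; rewrite [RHS]vl !opE vl vmode_lin.
  split=> [m n b x y|]; first by apply: val_inj; rewrite [RHS]vl !opE vl vmode_lin.
  split=> [m n r s x|]; last split=> m n r s x; apply: val_inj; rewrite (islinB _ _ vl) !opE.
  - exact: TT.
  - by rewrite [RHS]vl (islinZ _ _ vl) opE; exact: TE.
  - by rewrite [RHS]vl (islinZ _ _ vl) opE; exact: EE.
have HSa : nonneg_annihilated (fun m => op (false, m)) (fun m => op (true, m)) s1.
  move=> m n n0; have [h1 h2] := ann m n n0.
  by split; apply: val_inj; rewrite opE sm_subK.
have [[f [fl [f1 [fT fE]]]] _] := univ _ _ _ _ HS HSa.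
have [_ uniq] := univ V TV EV vac (conj Tl (conj El (conj TT (conj TE EE)))) ann.
move=> v; suff <- : val (f v) = v by exact: (@smP _ S (f v)).
apply: (uniq (fun v => val (f v)) id) => //.
- by move=> b x y; rewrite fl vl.
- by rewrite f1 sm_subK.
- by move=> m n v'; rewrite fT opE.
- by move=> m n v'; rewrite fE opE.
Qed.

Section StateFields.
Variables (W : lmodType C) (tW EW : int -> int -> W -> W).
Hypotheses (HW : Lstar_module l1 l2 l3 l4 tW EW) (Hres : restricted tW EW).

Lemma state_field_ex : exists c : V -> int -> W -> W,
  [/\ islin c, forall v, smooth tW EW (c v), c vac = @one_field W &
      forall g n v, c (vmode g n v) = zprod n (gen_field tW EW g) (c v)].
Proof.
have [_ [_ univ]] := HV.
have [[f [fl [f1 [fT fE]]]] _] := univ _ _ _ _ (smooth_Lhat HW Hres) (smooth_vac_ann HW Hres).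
exists (fun v => val (f v)); split.
- by move=> b x y; rewrite fl sm_valL.
- by move=> v; exact: (@smP _ (smooth_sm HW Hres) (f v)).
- by rewrite f1 sm_subK.
- by move=> [[] m] n v; rewrite /vmode /= ?fT ?fE smooth_opE.
Qed.

Variables (YV : V -> int -> V -> V).
Hypotheses (HVA : vertex_algebra vac YV)
  (HYT : forall m n v, YV (TV m (-1) vac) n v = TV m n v)
  (HYE : forall m n v, YV (EV m (-1) vac) n v = EV m n v).

Lemma vmodeE g n v : YV (vmode g (-1) vac) n v = vmode g n v.
Proof. by rewrite /vmode; case: g.1. Qed.

Lemma YV_linl n v : islin (fun u => YV u n v). Proof. by have [] := HVA. Qed.
Lemma YV_linr u n : islin (YV u n). Proof. by have [_ []] := HVA. Qed.
Lemma YV_trunc u v : exists N : int, forall n, N <= n -> YV u n v = 0.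
Proof. by have [_ [_ []]] := HVA. Qed.

Lemma YV_comm g u v (n q : int) : exists J0 : nat, forall J, (J0 <= J)%N ->
  vmode g n (YV u q v) - YV u q (vmode g n v)
  = \sum_(l < J) zbinom n l *: YV (vmode g l%:Z u) (n + q - l%:Z) v.
Proof.
have [_ [_ [tr [_ [_ [_ jac]]]]]] := HVA.
set a := vmode g (-1) vac.
have [N1 h1] := tr a u; have [N2 h2] := tr u v; have [N3 h3] := tr a v.
exists (absz N1 + absz (N2 - q)%R + absz (N3 - n)%R).+1 => J hJ.
have := jac a u v n q 0 J; case: J hJ => [|J] hJ; first by lia.
have side : forall i : nat, (J.+1 <= i)%N ->
    YV a (0 + i%:Z) u = 0 /\ YV u (q + i%:Z) v = 0 /\ YV a (n + i%:Z) v = 0.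
  by move=> i hi; rewrite h1 ?h2 ?h3 //; lia.
move=> /(_ side); rewrite [X in _ = X -> _]big_ord_recl [X in _ = _ + X -> _]big1 => [|i _];
  last first.
  by rewrite /= zbinom_0S mulr0 scale0r.
rewrite /= expr0 zbinom0 mulr1 scale1r expr0z scale1r !addr0 !vmodeE => <-.
by apply: eq_bigr => l _; rewrite add0r vmodeE.
Qed.

Lemma YV_m2 u (q : int) w : YV (YV u (-2) vac) q w = - (q%:~R *: YV u (q - 1) w).
Proof.
have [_ [_ [tr [Yv [ann [cre jac]]]]]] := HVA.
have [M hM] := tr u w; pose N := (absz M + absz q).+3.
have side (i : nat) : (N <= i)%N ->
    YV u (-2 + i%:Z) vac = 0 /\ YV vac (q + i%:Z) w = 0 /\ YV u (0 + i%:Z) w = 0.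
  rewrite /N => hi; split; first by rewrite ann //; lia.
  by rewrite Yv ifF ?hM //; lia.
have := jac u vac w 0 q (-2) N side.
rewrite [X in X = _ -> _]big_ord_recl [X in _ + X = _ -> _]big1 => [|i _]; last first.
  by rewrite /= zbinom_0S scale0r.
rewrite /= zbinom0 scale1r !addr0 add0r => ->.
have zb (i : nat) : (-1) ^+ i * zbinom (-2) i = i.+1%:R.
  elim: i => [|i IH]; first by rewrite expr0 zbinom0 mulr1.
  have i0 := natCS_neq0 i.
  rewrite exprS zbinomS.
  transitivity ((-1) ^+ i * zbinom (-2) i * (- ((-2 : int)%:~R - i%:R) / i.+1%:R)); first by ring.
  rewrite IH (_ : - ((-2 : int)%:~R - i%:R) = i.+2%:R); first by rewrite mulrCA mulfV // mulr1.
  by rewrite -addn2 natrD; ring.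
have Y0 n : YV u n 0 = 0 := islin0 (YV_linr u n).
pose G (i : nat) := i.+1%:R *: ((if q + i%:Z == -1 then YV u (-2 - i%:Z) w else 0)
   - (if q - 2 - i%:Z == -1 then YV u i%:Z w else 0) : V).
transitivity (\sum_(i < N) G i).
  apply: eq_bigr => i _; rewrite zb /G; congr (_ *: (_ - _)).
    by rewrite add0r Yv; case: ifP.
  rewrite (_ : (-1 : C) ^ (-2) = 1) ?scale1r ?Yv ?add0r //.
  by rewrite (_ : (-2 : int) = Negz 1) // /exprz sqrrN expr1n invr1.
pose j := if q <= 0 then absz (q + 1)%R else absz (q - 1)%R.
have jN : (j < N)%N by rewrite /j /N; case: ifP => _; lia.
have G0 (i : nat) : i != j -> G i = 0.
  by rewrite /G /j => ij; rewrite !ifF ?subrr ?scaler0 //; move: ij; case: ifP; lia.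
rewrite (bigD1 (Ordinal jN)) //= big1 ?addr0 => [|i]; last by rewrite -val_eqE; exact: G0.
rewrite /G /j; case: (ltrgtP q 0) => hq.
- rewrite ifT ?ifF ?subr0; try lia.
  rewrite -scaleNr; congr (_ *: YV u _ w); last by lia.
  by rewrite -mulrNz pmulrn; congr (_%:~R); lia.
- rewrite ifF ?ifT ?sub0r; try lia.
  rewrite scalerN; congr (- (_ *: YV u _ w)); last by lia.
  by rewrite pmulrn; congr (_%:~R); lia.
- by rewrite hq /= subrr scaler0 scale0r oppr0.
Qed.

Lemma YV_m2_vmode g m u :
  YV (vmode g m u) (-2) vac = vmode g m (YV u (-2) vac) - m%:~R *: vmode g (m - 1) u.
Proof.
have [_ [_ [tr [Yv [ann [cre jac]]]]]] := HVA.
set a := vmode g (-1) vac; have [M hM] := tr a u; pose N := (absz M + absz m).+2.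
have side (i : nat) : (N <= i)%N ->
    YV a (m + i%:Z) u = 0 /\ YV u (-2 + i%:Z) vac = 0 /\ YV a (0 + i%:Z) vac = 0.
  by rewrite /N => hi; rewrite hM ?ann //; lia.
have := jac a u vac 0 (-2) m N side.
rewrite [X in X = _ -> _]big_ord_recl [X in _ + X = _ -> _]big1 => [|i _]; last first.
  by rewrite /= zbinom_0S scale0r.
rewrite /= zbinom0 scale1r !addr0 add0r vmodeE => ->.
have Y0 n : YV u n 0 = 0 := islin0 (YV_linr u n).
have Ya0 n : YV a n 0 = 0 := islin0 (YV_linr a n).
rewrite 2!big_ord_recl [X in _ + (_ + X)]big1 => [|i _]; last first.
  by rewrite !(ann _ (_ + _)) ?Y0 ?Ya0 ?scaler0 ?subrr ?scaler0 //= /bump /=; lia.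
rewrite /= /bump /= !(ann _ (0 + _)) // !Y0 !scaler0 addn0 !add0r !addr0 !subr0 -[-2 +
  1%:Z]/(-1 : int).
rewrite expr0 zbinom0 mulr1 scale1r expr1 zbinomS zbinom0 mul1r subr0 divr1 mulN1r scaleNr.
by rewrite cre !vmodeE.
Qed.

Variable c : V -> int -> W -> W.
Hypotheses (cL : islin c) (cS : forall v, smooth tW EW (c v)) (c1 : c vac = @one_field W)
  (cX : forall g n v, c (vmode g n v) = zprod n (gen_field tW EW g) (c v)).

Let cf v : is_field (c v) := proj1 (cS v).
Let cl g v : local (gen_field tW EW g) (c v) := proj2 (cS v) g.
Let gf g : is_field (gen_field tW EW g) := gen_field_field HW Hres g.

Lemma c_lin (b : C) u v t w : c (b *: u + v) t w = b *: c u t w + c v t w.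
Proof. by rewrite cL. Qed.

Lemma c_gen g : c (vmode g (-1) vac) = gen_field tW EW g.
Proof.
rewrite cX c1; apply/funext => t; apply/funext => w.
by rewrite zprod_oner // /= fact0 invr1 expr0 mulr1 scale1r.
Qed.

Lemma c_m2 u : c (YV u (-2) vac) = xder (c u).
Proof.
move: u; apply: vacuum_module_ind => [|b x y hx hy||g m u IH].
- rewrite (islin0 (YV_linl (-2) vac)) (islin0 cL); apply/funext => t; apply/funext => w.
  by rewrite /xder scaler0.
- rewrite (YV_linl (-2) vac) cL hx hy cL; apply/funext => t; apply/funext => w.
  rewrite -[LHS]/(b *: (t%:~R *: c x t w) + t%:~R *: c y t w).
  by rewrite -[RHS]/(t%:~R *: (b *: c x t w + c y t w)) scalerDr !scalerA mulrC.
- have [_ [_ [_ [-> _]]]] := HVA; rewrite (islin0 cL) c1; apply/funext => t; apply/funext => w.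
  by rewrite -[LHS]/(0 : W) /xder /one_field; case: eqP => [->|_]; rewrite ?scale0r ?scaler0.
- rewrite YV_m2_vmode (islinB _ _ cL) (islinZ _ _ cL) !cX IH.
  apply/funext => t; apply/funext => w.
  transitivity (zprod m (gen_field tW EW g) (xder (c u)) t w
    - m%:~R *: zprod (m - 1) (gen_field tW EW g) (c u) t w) => //.
  by rewrite zprod_xderr // addrK.
Qed.

Lemma c_creation u n : c (YV u n vac) = zprod n (c u) (@one_field W).
Proof.
have [_ [_ [_ [_ [ann [cre _]]]]]] := HVA.
case: n => n.
  rewrite ann // (islin0 cL); apply/funext => t; apply/funext => w.
  by rewrite zprod_oner.
elim: n u => [|n IH] u; apply/funext => t; apply/funext => w; rewrite zprod_oner //=.
  by rewrite cre fact0 invr1 expr0 mulr1 scale1r.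
have e : YV u (Negz n.+1) vac = (n.+1%:R)^-1 *: YV (YV u (-2) vac) (Negz n) vac.
  rewrite YV_m2 (_ : Negz n - 1 = Negz n.+1); last lia.
  by rewrite !NegzE mulrNz scaleNr opprK scalerA -pmulrn mulVf ?scale1r // natCS_neq0.
rewrite e (islinZ _ _ cL) IH c_m2.
transitivity ((n.+1%:R)^-1 *: zprod (Negz n) (xder (c u)) (@one_field W) t w) => //.
rewrite zprod_oner //=; last exact: xder_field.
rewrite /xder !scalerA factS natrM invfM exprSr; congr (_ *: _); ring.
Qed.

Lemma c_zprod v u : local (c u) (c v) /\ forall n, c (YV u n v) = zprod n (c u) (c v).
Proof.
move: v u; apply: vacuum_module_ind => [u|b x y hx hy u|u|g m v IH u].
- rewrite (islin0 cL); split; first exact: local_r0.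
  move=> n; rewrite (islin0 (YV_linr u n)) (islin0 cL).
  by apply/funext => t; apply/funext => w; rewrite zprod_r0.
- have [lx ex] := hx u; have [ly ey] := hy u; rewrite cL; split; first exact: local_linr.
  move=> n; rewrite YV_linr cL ex ey; apply/funext => t; apply/funext => w.
  by rewrite [RHS]zprod_linr.
- rewrite c1; split; last by move=> n; exact: c_creation.
  by exists 0; exact: local_oner.
have [N0 h0] := cl g u.
have [lK eK] := IH u; have [K hK] := lK; have [A hA] := cl g v.
pose D l := c (vmode g (Posz l) u).
have Df l : is_field (D l) by exact: cf.
have Dl l : local (D l) (c v) by have [] := IH (vmode g (Posz l) u).
have cm (J : nat) : (absz N0 <= J)%N -> forall q r w,
    gen_field tW EW g (- q) (c u (- r) w) - c u (- r) (gen_field tW EW g (- q) w)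
    = \sum_(l < J) ((l`!%:R)^-1 * q%:~R ^+ l) *: D l (- (q + r)) w.
  move=> hJ q r w; have hl : loc J%:Z (gen_field tW EW g) (c u).
    by apply: (loc_le (gf g) (cf u) h0); lia.
  by rewrite (local_comm q r w (gf g) (cf u) hl); apply: eq_bigr => l _; rewrite /D cX.
rewrite cX; split.
  have [L hL] := loc_uniform (absz N0) Df (cf v) Dl.
  exact: (zprod_local (gf g) (cf u) (cf v) Df (cm _ (leqnn _)) hA hK hL).
move=> n; have [J0 hJ0] := YV_comm g u v m n.
pose J := (J0 + absz N0)%N.
have [L hL] := loc_uniform J Df (cf v) Dl.
have [hJ hJN] : (J0 <= J)%N /\ (absz N0 <= J)%N by rewrite leq_addr leq_addl.
apply/funext => t; apply/funext => w.
have ctl : islin (fun x => c x t w) by move=> b x y; rewrite c_lin.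
have zc := zprod_comm (gf g) (cf u) (cf v) Df (cm J hJN) hA hK (fun l lJ => hL l lJ) m n t w.
have vc := congr1 (fun x => c x t w) (hJ0 J hJ).
rewrite /= (islinB _ _ ctl) (islin_sum _ _ _ ctl) cX eK in vc.
apply/eqP; rewrite -eqr_opp -(inj_eq (addrI (zprod m (gen_field tW EW g) (zprod n (c u) (c v))
  t w))).
rewrite zc vc; apply/eqP/eq_bigr => l _.
rewrite (islinZ _ _ ctl); congr (_ *: _).
by have [_ ->] := IH (vmode g l u).
Qed.

Lemma c_assoc (k : nat) u v w N : loc k%:Z (c u) (c v) ->
  (forall a b : int, (a < N) || (b < N) -> prod_coef c k u v w a b = 0) ->
  forall M : int, (forall n : int, M <= n -> YV u n v = 0) ->
  forall s q : int, assoc_coef YV c k u v w M s q =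
    if q < 0 then 0 else subst_coef (prod_coef c k u v w) N s (absz q).
Proof.
move=> lk tr M hM s q; have [_ ez] := c_zprod v u.
pose y i := rprod 0 i (c u) (c v) (s - k%:Z) w.
have vy : vanish_from k%:Z y := loc_vanish 0 _ _ (cf u) (cf v) lk.
have E n : c (YV u n v) (s - k%:Z) w = zact n y by rewrite ez.
transitivity (assoc_sum k (fun n => zact n y) M q).
  apply: eq_bigr => p _; congr (_ *: _); apply: eq_bigr => j _; congr (_ *: _).
  exact: E.
rewrite (assoc_sum_zact _ _ vy) => [|n hn]; last by rewrite -E hM // (islin0 cL).
rewrite (zact_moment _ _ _ (cf u) (cf v) lk).
have -> : (0 <= - q - 1) = (q < 0) by apply/idP/idP; lia.
case: ifP => // q0; have -> : (absz (- q - 1)%R).-1 = absz q by lia.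
set r := absz q; rewrite /subst_coef.
pose f (a : int) := a%:~R ^+ r *: prod_coef c k u v w a (s - a).
transitivity (zsum (fun a => (r`!%:R)^-1 *: f a)).
  apply: eq_zsum => a; rewrite /f scalerA prod_coefE.
  by rewrite (_ : a + (s - a) - k%:Z = s - k%:Z) //; ring.
have f0 a : (a < N) || (s - N < a) -> f a = 0.
  by move=> h; rewrite /f tr ?scaler0 //; lia.
rewrite zsumZ; last exact: bounded_range f0.
congr (_ *: _).
case: (lerP (s - 2 * N + 1) 0) => hs.
  rewrite big_pred0 => [|i]; last by apply/negbTE; lia.
  by rewrite -[RHS](zsum0 W); apply: eq_zsum => a; apply: f0; lia.
rewrite (@zsum_range _ N (absz (s - 2 * N + 1)%R)) => [|a ha]; last by apply: f0; lia.
rewrite [RHS](eq_bigl xpredT) => [|i]; last by have := ltn_ord i; lia.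
by apply: eq_bigr => i _; rewrite /f opprD addrA.
Qed.

Lemma c_phi : phi_coordinated_module vac YV c.
Proof.
split; first by move=> n w b x y; rewrite c_lin.
split; first by move=> v n; exact: field_lin.
split; first by move=> v w; exact: field_lb.
split; first by move=> n w; rewrite c1.
move=> u v; have [[K hK] _] := c_zprod v u; exists (absz K) => w.
have lk : loc (absz K)%:Z (c u) (c v) by apply: (loc_le (cf u) (cf v) hK); lia.
have [N hN] := loc_truncated w (cf u) (cf v) lk.
have tr a b : (a < N) || (b < N) -> prod_coef c (absz K) u v w a b = 0.
  by move=> h; rewrite prod_coefE hN.
by exists N; split=> // M hM s q; exact: c_assoc.
Qed.

Lemma c_unique YW : phi_coordinated_module vac YV YW ->
  generating_fields TV EV vac tW EW YW -> forall v n w, YW v n w = c v n w.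
Proof.
move=> [Yl [Ywl [_ [Y1 Ya]]]] gen.
have Yg g : YW (vmode g (-1) vac) = c (vmode g (-1) vac).
  rewrite c_gen; apply/funext => n; apply/funext => w; have [h1 h2] := gen g.2 n w.
  by rewrite /gen_field /gen_mode /vmode; case: g.1.
suff H v : YW v = c v by move=> v n w; rewrite H.
move: v; apply: vacuum_module_ind => [|b x y hx hy||g m v IH].
- rewrite (islin0 cL); apply/funext => n; apply/funext => w.
  by rewrite (islin0 (Yl n w)).
- rewrite cL -hx -hy; apply/funext => n; apply/funext => w; exact: Yl.
- by rewrite c1; apply/funext => n; apply/funext => w; rewrite Y1.
set u := vmode g (-1) vac; have [k hk] := Ya u v.
have pc w a b : prod_coef YW k u v w a b = prod_coef c k u v w a b.
  by rewrite !prod_coefE Yg IH.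
have lk : loc k%:Z (c u) (c v).
  apply: loc_of_truncated => // [|w]; first by have [] := c_zprod v u.
  have [N [hN _]] := hk w; exists N => x y hx.
  by rewrite -prod_coefE -pc hN // hx.
rewrite -vmodeE; apply/funext => t; apply/funext => w.
have [M hM] := YV_trunc u v; have [N [hN hA]] := hk w.
apply/eqP; rewrite -subr_eq0; apply/eqP.
pose h n := YW (YV u n v) t w - c (YV u n v) t w.
apply: (@assoc_sum_inj W k h M _ _ m) => [n hn|q].
  by rewrite /h hM // (islin0 (Yl t w)) (islin0 cL) subrr.
have e1 := hA M hM (t + k%:Z) q.
have tr a b : (a < N) || (b < N) -> prod_coef c k u v w a b = 0.
  by move=> hab; rewrite -pc hN.
have e2 := c_assoc lk tr hM (t + k%:Z) q.
have e3 : assoc_coef YV YW k u v w M (t + k%:Z) q = assoc_coef YV c k u v w M (t + k%:Z) q.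
  rewrite e1 e2; case: ifP => // _; rewrite /subst_coef; congr (_ *: _).
  by apply: eq_bigr => i _; rewrite pc.
move/eqP: e3; rewrite -subr_eq0 => /eqP <-; rewrite /assoc_coef -sumrB.
apply: eq_bigr => p _; rewrite -scalerBr; congr (_ *: _); rewrite -sumrB.
by apply: eq_bigr => j _; rewrite -scalerBr addrK.
Qed.

End StateFields.
End VacuumModule.

Theorem theorem4p5 (l1 l2 l3 l4 : C)
    (W : lmodType C) (tW EW : int -> int -> W -> W)
    (HW : Lstar_module l1 l2 l3 l4 tW EW) (Hres : restricted tW EW)
    (V : lmodType C) (TV EV : int -> int -> V -> V) (vac : V)
    (HV : vacuum_module l1 l2 l3 l4 TV EV vac)
    (YV : V -> int -> V -> V) (HVA : vertex_algebra vac YV)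
    (HYT : forall m n v, YV (TV m (-1) vac) n v = TV m n v)
    (HYE : forall m n v, YV (EV m (-1) vac) n v = EV m n v) :
  exists YW : V -> int -> W -> W,
    phi_coordinated_module vac YV YW /\
    generating_fields TV EV vac tW EW YW /\
    (forall YW' : V -> int -> W -> W,
       phi_coordinated_module vac YV YW' ->
       generating_fields TV EV vac tW EW YW' ->
       forall v n w, YW' v n w = YW v n w).
Proof.
have [c [cL cS c1 cX]] := state_field_ex HV HW Hres.
exists c; split; first exact: (c_phi HV HW Hres HVA HYT HYE cL cS c1 cX).
split; last by move=> YW'; exact: (c_unique HV HW Hres HVA HYT HYE cL cS c1 cX).
move=> m n w; have cT := c_gen HW Hres c1 cX (false, m).
by have cE := c_gen HW Hres c1 cX (true, m); rewrite /vmode /= in cT cE; rewrite cT cE.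
Qed.
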